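(* Fix a positive integer $k$. Let $g:[0,1]\to[0,\infty)$ be continuous with $g(2^{-k})=k2^{-k}$, and let $f:[0,\infty)\to[0,\infty)$ be increasing and strictly concave with $f(0)=0$ and $f(k)=k$. Suppose that for every $n\ge1$ and every $A\subseteq\{0,1\}^n$, $\int f(h_A)\,d\mu\ge g(\mu(A))$ (with $\mu$ uniform on $\{0,1\}^n$). Then there is a constant $K=K(f,g)>0$ such that for every $n$, every $\varepsilon>0$ and every partition $(A,B,W)$ of $V=\{0,1\}^n$ with $(1-\varepsilon)2^{-k}\le\mu(A)\le(1+\varepsilon)2^{-k}$, $\mu(W)\le \varepsilon/f(n)$ and $|\nabla(A,B)|<(1+\varepsilon)k2^{n-k}$: there is $I\subseteq[n]$ with $|I|=k$ such that $|\nabla_iA|\ge(1-K\varepsilon)2^{n-k}$ for all $i\in I$, and there is a codimension-$k$ subcube $C$ with $\mu(C\,\Delta\,A)\le K\varepsilon$.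
   Context: $V=\{0,1\}^n$ is the vertex set of the Hamming cube $Q_n$ (vertices adjacent iff they differ in exactly one coordinate). $d_T(x)$ is the number of neighbors of $x$ in $T$; $h_S(x)=d_{V\setminus S}(x)$ for $x\in S$ and $h_S(x)=0$ for $x\notin S$. $\int F\,d\mu=2^{-n}\sum_{x\in V}F(x)$. For $x\in V$, $x^i$ is $x$ with coordinate $i$ flipped. $\nabla(A,B)$ is the set of adjacent pairs $(x,y)$ with $x\in A$, $y\in B$; $\nabla_iA=\{(x,x^i):x\in A,\ x^i\notin A\}$. A codimension-$k$ subcube is $\{x: x_i=z_i\ \forall i\in I\}$ for some $|I|=k$, $z\in\{0,1\}^I$.
   Formalization: The formal theorem requires n ≥ k: for n < k no I ⊆ [n] with |I| = k and no codimension-k subcube exists, while for large ε the hypotheses can hold (e.g. k = 2, n = 1, ε = 1, A = W = ∅), so the claim for every n is false as written. *)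

(* Defs.v *)
From mathcomp Require Import all_boot.
From Stdlib Require Import Reals.

Set Implicit Arguments.
Unset Strict Implicit.
Unset Printing Implicit Defensive.

Definition cube (n : nat) := {ffun 'I_n -> bool}.

Definition adjacent n (x y : cube n) : bool := #|[set i | x i != y i]| == 1%N.

Definition flip n (x : cube n) (i : 'I_n) : cube n :=
  [ffun j => if j == i then ~~ x j else x j].

Definition deg n (T : {set cube n}) (x : cube n) : nat :=
  #|[set y in T | adjacent x y]|.

Definition hS n (S : {set cube n}) (x : cube n) : nat :=
  if x \in S then deg (~: S) x else 0%N.

Definition mu n (A : {set cube n}) : R := (INR #|A| / 2 ^ n)%R.

Definition integral n (F : cube n -> R) : R :=
  ((\big[Rplus/0%R]_(x : cube n) F x) / 2 ^ n)%R.

Definition edge_bd n (A B : {set cube n}) : nat :=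
  #|[set p : cube n * cube n | [&& p.1 \in A, p.2 \in B & adjacent p.1 p.2]]|.

Definition dir_bd n (A : {set cube n}) (i : 'I_n) : nat :=
  #|[set p : cube n * cube n | [&& p.1 \in A, p.2 == flip p.1 i & p.2 \notin A]]|.

Definition subcube n (k : nat) (C : {set cube n}) : Prop :=
  exists (I : {set 'I_n}) (z : cube n),
    #|I| = k /\ C = [set x : cube n | [forall i in I, x i == z i]].

Definition symdiff T (A B : {set T}) : {set T} := (A :\: B) :|: (B :\: A).

(* Main.v *)
(** The hypothesis at Hamming balls forces f(n) >= c sqrt n, so that the exceptional set W satisfies
    sqrt n mu(W) = O(eps); an inequality of Talagrand type, int sqrt(h_S) >= J(mu S) with J superlinear at 0, then shows
    that small sets S expand even when edges into W are not counted.  Strict concavity makes the hypothesis rigid: a set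
    of measure close to 2^-k whose edge boundary is close to k 2^-k has h = k almost everywhere.

    For T a set of coordinates write x + T for x with the coordinates in T flipped.  In one more dimension put the union
    of A and A + T on one level and their intersection on the other.  The measure is that of A, and the edge boundary
    exceeds that of A by at most O(eta), where eta is the measure of V = A \ (A + T).  Rigidity bounds the number of edges
    between V and the rest of A by O(eta), so V does not expand: eta is either o(1) or bounded below.  Adding the
    coordinates to T one at a time, eta can only jump at one of the boundedly many coordinates J of large influence;
    hence eta = o(1) for all T avoiding J, and averaging over T, A is close to a set D depending only on J.  Every
    point of D has at most k neighbours outside D and |D| = 2^(n-k), so D is a subcube.

    Once A is close to a subcube C, the sets A \ C and C \ A are small, so they expand and create additional A-B edges
    in number proportional to their measure; the bound on the number of A-B edges makes this measure O(eps). *)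
From HB Require Import structures.
Require Import Defs.
From mathcomp Require Import all_boot zify.
From Stdlib Require Import Reals Lra Psatz.

Set Implicit Arguments.
Unset Strict Implicit.
Unset Printing Implicit Defensive.

(* Reals rebinds [^] on [nat] to [Nat.pow]. *)
Notation "m ^ n" := (expn m n) : nat_scope.

(** * Sums over the cube *)

HB.instance Definition _ := Monoid.isComLaw.Build R 0%R Rplus
  (fun x y z => esym (Rplus_assoc x y z)) Rplus_comm Rplus_0_l.
HB.instance Definition _ := Monoid.isMulLaw.Build R 0%R Rmult Rmult_0_l Rmult_0_r.
HB.instance Definition _ := Monoid.isAddLaw.Build R Rmult Rplus
  Rmult_plus_distr_r Rmult_plus_distr_l.

Notation "\rsum_ ( x | P ) F" := (\big[Rplus/0%R]_(x | P) F%R)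
  (at level 41, F at level 41, x at level 50).
Notation "\rsum_ ( x 'in' A ) F" := (\big[Rplus/0%R]_(x in A) F%R)
  (at level 41, F at level 41, x, A at level 50).
Notation "\rsum_ x F" := (\big[Rplus/0%R]_x F%R)
  (at level 41, F at level 41, x at level 0).

Lemma rsum_le (I : finType) (P : pred I) (F G : I -> R) :
  (forall x, P x -> (F x <= G x)%R) -> (\rsum_(x | P x) F x <= \rsum_(x | P x) G x)%R.
Proof. move=> H; elim/big_ind2: _ => //; [exact: Rle_refl | move=> *; lra]. Qed.

Lemma rsum_ge0 (I : finType) (P : pred I) (F : I -> R) :
  (forall x, P x -> (0 <= F x)%R) -> (0 <= \rsum_(x | P x) F x)%R.
Proof. move=> H; elim/big_ind: _ => //; [exact: Rle_refl | move=> *; lra]. Qed.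

Lemma INR_sum (I : finType) (P : pred I) (F : I -> nat) :
  INR (\sum_(x | P x) F x) = \rsum_(x | P x) INR (F x).
Proof. by apply: big_morph => // x y; rewrite plus_INR. Qed.

Lemma card_indicator (I : finType) (A : {set I}) : #|A| = \sum_x (x \in A).
Proof. by rewrite -sum1_card big_mkcond; apply: eq_bigr => x _; case: ifP. Qed.

Lemma INR_card (I : finType) (A : {set I}) :
  INR #|A| = \rsum_x INR (x \in A).
Proof. by rewrite -INR_sum -card_indicator. Qed.

Lemma INR_addn m n : INR (m + n)%N = (INR m + INR n)%R.
Proof. exact: plus_INR. Qed.

Lemma INR_muln m n : INR (m * n)%N = (INR m * INR n)%R.
Proof. exact: mult_INR. Qed.

Lemma INR_leq m n : (m <= n)%N -> (INR m <= INR n)%R.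
Proof. by move/leP; exact: le_INR. Qed.

(** * Flips, degrees, and the splitting of the cube along its first coordinate *)

Section Cube.
Implicit Types (n : nat) (b : bool).

Lemma flipE n (x : cube n) i j : flip x i j = x j (+) (j == i).
Proof. by rewrite ffunE; case: eqP => _; rewrite ?addbT ?addbF. Qed.

Lemma flipK n (i : 'I_n) : involutive (fun x : cube n => flip x i).
Proof. by move=> x; apply/ffunP=> j; rewrite !flipE -addbA addbb addbF. Qed.

Lemma flip_inj n (x : cube n) : injective (flip x).
Proof.
move=> i j /ffunP/(_ i); rewrite !flipE eqxx => /addbI.
by move/esym/eqP.
Qed.

Lemma adjacentP n (x y : cube n) :
  reflect (exists i, y = flip x i) (adjacent x y).
Proof.
apply: (iffP cards1P) => [[i Hi]|[i ->]]; exists i.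
  apply/ffunP=> j; rewrite flipE; move/setP/(_ j): Hi; rewrite !inE => <-.
  by case: (x j) (y j) => [] [].
by apply/setP => j; rewrite !inE flipE; case: (x j); case: (j == i).
Qed.

Lemma degE n (T : {set cube n}) x : deg T x = \sum_(i < n) (flip x i \in T).
Proof.
have -> : \sum_(i < n) (flip x i \in T) = #|[set i | flip x i \in T]|.
  by rewrite -sum1_card [RHS]big_mkcond /=; apply: eq_bigr => i _; rewrite inE; case: ifP.
rewrite /deg -(card_imset _ (@flip_inj n x)); apply: eq_card => y; rewrite inE.
apply/andP/imsetP => [[yT /adjacentP [i yE]]|[i]].
  by exists i; rewrite // inE -yE.
rewrite inE => iT ->.
by split=> //; apply/adjacentP; exists i.
Qed.

Lemma edge_bdE n (A B : {set cube n}) : edge_bd A B = \sum_(x in A) deg B x.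
Proof.
rewrite /edge_bd -sum1_card (eq_bigl (fun p : cube n * cube n =>
  (p.1 \in A) && ((p.2 \in B) && adjacent p.1 p.2))); last by move=> p; rewrite inE.
rewrite -(pair_big_dep (fun x => x \in A) (fun x y => (y \in B) && adjacent x y)
  (fun _ _ => 1)) /=.
by apply: eq_bigr => x _; rewrite /deg -sum1_card; apply: eq_bigl => y; rewrite inE.
Qed.

Lemma dir_bdE n (A : {set cube n}) i : dir_bd A i = #|[set x in A | flip x i \notin A]|.
Proof.
rewrite /dir_bd -(card_imset _ (can_inj (f := fun x => (x, flip x i)) (g := fst) (fun _ => erefl))).
apply: eq_card => -[x y]; rewrite !inE /=.
apply/and3P/imsetP => [[xA /eqP -> yA]|[z]].
  by exists x; rewrite // inE xA.
by rewrite inE => /andP [zA fA] [-> ->].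
Qed.

Lemma deg_le n (T : {set cube n}) x : deg T x <= n.
Proof.
rewrite degE -[X in _ <= X]card_ord -sum1_card; apply: leq_sum => i _.
by case: (_ \in _).
Qed.

Lemma degS n (S T : {set cube n}) x : S \subset T -> deg S x <= deg T x.
Proof.
move=> ST; rewrite !degE; apply: leq_sum => i _.
by have := subsetP ST (flip x i); case: (_ \in S) => // ->.
Qed.

Lemma degU n (S T : {set cube n}) x : deg (S :|: T) x <= deg S x + deg T x.
Proof.
rewrite !degE -big_split /=; apply: leq_sum => i _; rewrite inE.
by case: (_ \in S); case: (_ \in T).
Qed.

(** Sorted by direction, the edges are reversed by the flip, which is an involution. *)
Lemma edge_bdC n (A B : {set cube n}) : edge_bd A B = edge_bd B A.
Proof.
rewrite !edge_bdE.
have E (S T : {set cube n}) : \sum_(x in S) deg T x = \sum_(i < n) \sum_x ((x \in S) && (flip x i \in T)).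
  rewrite exchange_big big_mkcond /=; apply: eq_bigr => x _.
  by case: (x \in S); rewrite ?degE // big1.
rewrite !E; apply: eq_bigr => i _.
rewrite (reindex_inj (inv_inj (@flipK n i))) /=; apply: eq_bigr => x _.
by rewrite flipK andbC.
Qed.

Lemma card_cube n : #|{: cube n}| = 2 ^ n.
Proof. by rewrite card_ffun card_bool card_ord. Qed.

Definition cons n b (x : cube n) : cube n.+1 :=
  [ffun j => oapp x b (unlift ord0 j)].

Lemma cons0 n b (x : cube n) : cons b x ord0 = b.
Proof. by rewrite ffunE unlift_none. Qed.

Lemma consS n b (x : cube n) i : cons b x (lift ord0 i) = x i.
Proof. by rewrite ffunE liftK. Qed.

Lemma consP n (y : cube n.+1) : y = cons (y ord0) [ffun i => y (lift ord0 i)].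
Proof.
apply/ffunP => j; rewrite !ffunE.
by case: unliftP => [i ->|->] //=; rewrite ffunE.
Qed.

Lemma flip_cons0 n b (x : cube n) : flip (cons b x) ord0 = cons (~~ b) x.
Proof.
apply/ffunP => j; rewrite flipE.
by case: (unliftP ord0 j) => [i ->|->]; rewrite ?consS ?cons0 ?addbF // eqxx addbT.
Qed.

Lemma flip_consS n b (x : cube n) i : flip (cons b x) (lift ord0 i) = cons b (flip x i).
Proof.
apply/ffunP => j; rewrite flipE.
case: (unliftP ord0 j) => [l ->|->]; rewrite ?consS ?cons0 ?addbF //.
by rewrite flipE (inj_eq (@lift_inj _ _)).
Qed.

Lemma big_cons_cube (T : Type) (idx : T) (op : Monoid.com_law idx) n (F : cube n.+1 -> T) :
  \big[op/idx]_y F y =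
  op (\big[op/idx]_x F (cons true x)) (\big[op/idx]_x F (cons false x)).
Proof.
have -> : \big[op/idx]_y F y = \big[op/idx]_b \big[op/idx]_x F (cons b x).
  rewrite pair_big /=.
  rewrite (reindex (fun p : bool * cube n => cons p.1 p.2)) //=.
  exists (fun y : cube n.+1 => (y ord0, [ffun i => y (lift ord0 i)])) => [[b x] _|y _] /=.
    by rewrite cons0; congr (_, _); apply/ffunP => i; rewrite !ffunE liftK.
  by rewrite -consP.
by rewrite big_bool.
Qed.

Definition slice n b (S : {set cube n.+1}) : {set cube n} := [set x | cons b x \in S].

Lemma in_slice n b (S : {set cube n.+1}) x : (x \in slice b S) = (cons b x \in S).
Proof. by rewrite inE. Qed.

Lemma card_slice n (S : {set cube n.+1}) : #|S| = #|slice true S| + #|slice false S|.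
Proof.
rewrite !card_indicator big_cons_cube.
by congr (_ + _); apply: eq_bigr => x _; rewrite in_slice.
Qed.

Lemma deg_cons n (S : {set cube n.+1}) b x :
  deg S (cons b x) = (x \in slice (~~ b) S) + deg (slice b S) x.
Proof.
rewrite !degE big_ord_recl /= flip_cons0 in_slice; congr (_ + _).
by apply: eq_bigr => i _; rewrite flip_consS in_slice.
Qed.

End Cube.

(** * Sets of small outer degree *)

Lemma slice_setC n b (S : {set cube n.+1}) : slice b (~: S) = ~: slice b S.
Proof. by apply/setP => x; rewrite !inE. Qed.

Lemma slices_eq n (S T : {set cube n.+1}) :
  (forall b, slice b S = slice b T) -> S = T.
Proof.
move=> E; apply/setP => y; rewrite (consP y) -!in_slice.
by rewrite E.
Qed.

Lemma subcube_cons1 n k b (S : {set cube n.+1}) :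
  slice (~~ b) S = set0 -> subcube k (slice b S) -> subcube k.+1 S.
Proof.
move=> S0 [I [z [cI SE]]].
exists (ord0 |: [set lift ord0 i | i in I]), (cons b z); split.
  rewrite cardsU1 card_imset ?cI; last exact: lift_inj.
  by rewrite (_ : _ \notin _) //; apply/imsetP => -[i _] /eqP; rewrite -(inj_eq val_inj).
apply: slices_eq => b'; apply/setP => x; rewrite [RHS]in_slice [RHS]inE.
have -> : [forall i in ord0 |: [set lift ord0 i | i in I], cons b' x i == cons b z i] =
    (b' == b) && [forall i in I, x i == z i].
  apply/forall_inP/andP => [H|[/eqP -> /forall_inP H] i].
    split; first by have := H ord0; rewrite !cons0; apply; rewrite setU11.
    apply/forall_inP => i iI; have := H (lift ord0 i); rewrite !consS; apply.
    by rewrite inE imset_f ?orbT.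
  rewrite !inE => /orP [/eqP ->|/imsetP [j jI ->]]; first by rewrite !cons0.
  by rewrite !consS H.
have [->|] := eqVneq b' b; first by rewrite SE inE.
move=> bb; have -> : b' = ~~ b by case: b b' bb {S0 SE} => [] [].
by rewrite S0 inE.
Qed.

Lemma subcube_cons2 n k (S : {set cube n.+1}) :
  slice true S = slice false S -> subcube k (slice true S) -> subcube k S.
Proof.
move=> TF [I [z [cI SE]]].
exists [set lift ord0 i | i in I], (cons true z); split.
  by rewrite card_imset ?cI //; exact: lift_inj.
apply: slices_eq => b; apply/setP => x; rewrite [RHS]in_slice [RHS]inE.
have -> : slice b S = slice true S by case: b.
rewrite SE inE; apply/forall_inP/forall_inP => [H i /imsetP [j jI ->]|H i iI].
  by rewrite !consS H.
by have := H (lift ord0 i); rewrite !consS; apply; rewrite imset_f.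
Qed.

(** From a point of [C], a flip leaves [C] exactly when its coordinate is one of the [k] fixed
    ones. *)
Lemma subcube_deg n k (C : {set cube n}) x :
  subcube k C -> x \in C -> deg (~: C) x = k.
Proof.
move=> [I [z [<- ->]]]; rewrite inE => /forall_inP xC.
rewrite degE -sum1_card [RHS]big_mkcond /=; apply: eq_bigr => i _; rewrite !inE.
case: ifP => iI; last first.
  suff -> : [forall j in I, flip x i j == z j] by [].
  apply/forall_inP => j jI; rewrite flipE (eqP (xC j jI)).
  by have [ji|] := eqVneq j i; [rewrite -ji jI in iI | rewrite addbF].
suff -> : [forall j in I, flip x i j == z j] = false by [].
apply/forall_inP => /(_ i iI); rewrite flipE eqxx (eqP (xC i iI)).
by case: (z i).
Qed.

(** Induction on [n]. If one half of [S] is empty, each point of the other half has an outer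
    neighbour across, and [k] drops by one. Otherwise both halves satisfy the hypothesis with the
    same [k]. In the extremal case both are subcubes whose points already have [k] outer neighbours
    inside their half, so none is left across and the halves coincide. *)
Lemma outdeg_subcube n k (S : {set cube n}) :
  (forall x, x \in S -> deg (~: S) x <= k) -> S != set0 ->
  2 ^ n <= #|S| * 2 ^ k /\ (#|S| * 2 ^ k <= 2 ^ n -> subcube k S).
Proof.
elim: n k S => [|n IHn] k S degS_ /set0Pn [y yS].
  have -> : S = setT.
    by apply/setP => x; rewrite inE -yS; congr (_ \in S); apply/ffunP => -[].
  rewrite cardsT card_cube; split; first by rewrite mul1n expn_gt0.
  case: k {degS_} => [|k]; last by rewrite mul1n expnS; have := expn_gt0 2 k; lia.
  move=> _; exists set0, y; rewrite cards0; split=> //.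
  by apply/setP => x; rewrite !inE; apply/esym/forall_inP => i; rewrite inE.
have deg_slice b x : x \in slice b S ->
    (x \notin slice (~~ b) S) + deg (~: slice b S) x <= k.
  by rewrite in_slice => /degS_; rewrite deg_cons !slice_setC inE.
have cardE b : #|S| = #|slice b S| + #|slice (~~ b) S|.
  by rewrite card_slice; case: b => //=; rewrite addnC.
have one b : slice (~~ b) S = set0 ->
    2 ^ n.+1 <= #|S| * 2 ^ k /\ (#|S| * 2 ^ k <= 2 ^ n.+1 -> subcube k S).
  move=> S0; rewrite (cardE b) S0 cards0 addn0.
  have [x xb] : exists x, x \in slice b S.
    apply/set0Pn; apply: contraTneq isT => Sb0.
    by have := cards0 (cube n.+1); rewrite (cardsD1 y) => _;
       move: (cardE b) (cardsD1 y S); rewrite Sb0 S0 !cards0 yS => ->.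
  have k0 : 0 < k by have := deg_slice b x xb; rewrite S0 inE /=; lia.
  case: k k0 deg_slice {degS_} => // k _ deg_slice.
  have [|//|lo up] := IHn k (slice b S); first by move=> u ub; have := deg_slice b u ub; rewrite S0 inE /=; lia.
    by apply/set0Pn; exists x.
  rewrite !expnS; split; first by lia.
  by move=> le; apply: (subcube_cons1 S0); apply: up; lia.
have [/one //|nF] := eqVneq (slice (~~ true) S) set0.
have [/(one false) //|nT] := eqVneq (slice true S) set0.
have [|//|loT upT] := IHn k (slice true S).
  by move=> x xb; have := deg_slice true x xb; lia.
have [|//|loF upF] := IHn k (slice false S).
  by move=> x xb; have := deg_slice false x xb; lia.
rewrite (cardE true) expnS mulnDl mul2n -addnn; split; first exact: leq_add.
move=> le.
(* Each half attains at least its lower bound, so equality in the sum forces equality in both. *)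
have cT : subcube k (slice true S) 
  by apply: upT; rewrite -(leq_add2r (2 ^ n)) (leq_trans _ le) // leq_add2l.
have cF : subcube k (slice false S) 
  by apply: upF; rewrite -(leq_add2l (2 ^ n)) (leq_trans _ le) // leq_add2r.
apply: subcube_cons2 => //; apply/eqP; rewrite eqEsubset.
apply/andP; split; apply/subsetP => x xb.
  by have := deg_slice true x xb; rewrite (subcube_deg cT xb) /=; case: (_ \in _) => //; lia.
by have := deg_slice false x xb; rewrite (subcube_deg cF xb) /=; case: (_ \in _) => //; lia.
Qed.

(** * Expansion of small sets *)

Lemma ln_le_sub1 x : (0 < x -> ln x <= x - 1)%R.
Proof. by move=> x0; have := exp_ineq1_le (ln x); rewrite exp_ln //; lra. Qed.


Lemma ln_diff_le x y : (0 < x -> 0 < y -> ln y - ln x <= (y - x) / x)%R.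
Proof.
move=> x0 y0; have xV := Rinv_0_lt_compat x x0.
have -> : (ln y - ln x = ln (y * / x))%R by rewrite ln_mult // ln_Rinv.
have := @ln_le_sub1 (y * / x)%R (Rmult_lt_0_compat _ _ y0 xV).
by have -> : ((y - x) / x = y * / x - 1)%R by field; lra.
Qed.

(* The subtracted linear term makes [profile] vanish at 1; it only helps in the two-point inequality. *)
Definition profile (x : R) : R := (x * (sqrt (1 - ln x) - 1))%R.

(** Used with [a = m (1 + r)], [b = m (1 - r)], [p ^ 2 = 1 - ln m], [q ^ 2 = 1 - ln b] and
    [al = 1 - ln a]. The last three hypotheses are tangent bounds for [ln]; the factor [m ^ 2] has
    been divided out. *)
Lemma two_point_core (r p q al : R) :
  (0 <= r < 1 -> 1 <= p <= q -> p ^ 2 - r <= al ->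
   r <= q ^ 2 - p ^ 2 -> (q ^ 2 - p ^ 2) * (1 - r) <= r ->
   ((1 + r) * p - (1 - r) * (q - p)) ^ 2 <= (1 + r) ^ 2 * al + 8 * r ^ 2)%R.
Proof.
move=> [r0 r1] [p1 pq] Hal v1 v2.
set w := (q - p)%R; set v := (q ^ 2 - p ^ 2)%R in v1 v2.
have w0 : (0 <= w)%R by rewrite /w; lra.
have vw : (v = w * (p + q))%R by rewrite /v /w; ring.
have w_le : ((1 - r) * w <= r / 2)%R.
  have : (0 <= (1 - r) * w * (p + q - 2))%R by apply: Rmult_le_pos; nra.
  by rewrite vw in v2; lra.
have sq_le : (((1 - r) * w) ^ 2 <= r ^ 2 / 4)%R.
  have : (0 <= (1 - r) * w)%R by nra.
  nra.
(* The cross term makes up for the first-order loss in [p ^ 2 - r <= al]; what remains is quadratic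
   in [r] and fits under [8 * r ^ 2]. *)
have cross : (r * (1 - 2 * r) <= (1 - r) * (2 * p * w))%R.
  have Z : (1 - v <= 2 * p / (p + q))%R.
    apply: (Rmult_le_reg_r (p + q)); first lra.
    have -> : (2 * p / (p + q) * (p + q) = 2 * p)%R by field; lra.
    have : (0 <= w * ((p + q) ^ 2 - 1))%R by apply: Rmult_le_pos => //; nra.
    by rewrite vw /w; lra.
  have -> : ((1 - r) * (2 * p * w) = v * ((1 - r) * (2 * p / (p + q))))%R.
    by rewrite vw; field; lra.
  set z := (2 * p / (p + q))%R in Z *.
  have z0 : (0 <= z)%R by apply: Rmult_le_pos; [lra | apply/Rlt_le/Rinv_0_lt_compat; lra].
  have : ((1 - r) * (1 - v) <= (1 - r) * z)%R by nra.
  have : (0 <= (1 - r) * z)%R by nra.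
  set y := ((1 - r) * z)%R => y0 yv.
  have : (1 - 2 * r <= y)%R by nra.
  nra.
have -> : (((1 + r) * p - (1 - r) * w) ^ 2 =
   (1 + r) ^ 2 * p ^ 2 - (1 + r) * ((1 - r) * (2 * p * w)) + ((1 - r) * w) ^ 2)%R by ring.
have : ((1 + r) * (r * (1 - 2 * r)) <= (1 + r) * ((1 - r) * (2 * p * w)))%R by nra.
have : ((1 + r) ^ 2 * (p ^ 2 - r) <= (1 + r) ^ 2 * al)%R by nra.
nra.
Qed.

Lemma le_sqrt_sq x y : (x ^ 2 <= y -> x <= sqrt y)%R.
Proof.
move=> H; case: (Rle_lt_dec 0 x) => x0; last by have := sqrt_pos y; lra.
by rewrite -(sqrt_pow2 x x0); apply: sqrt_le_1_alt.
Qed.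

Lemma ln_le1 x : (0 < x <= 1 -> ln x <= 0)%R.
Proof. by move=> x01; have := @ln_le_sub1 x (proj1 x01); lra. Qed.

Lemma profile_ge0 x : (0 <= x <= 1 -> 0 <= profile x)%R.
Proof.
move=> [x0 x1]; apply: Rmult_le_pos => //.
case: x0 => [x0|<-].
  have l0 := @ln_le1 x (conj x0 x1).
  have : (1 <= sqrt (1 - ln x))%R by apply: le_sqrt_sq; lra.
  lra.
(* At 0 the library value [ln 0 = 0] makes the second factor vanish. *)
have -> : (ln 0 = 0)%R by rewrite /ln; case: Rlt_dec => // H; case: (Rlt_irrefl _ H).
rewrite Rminus_0_r sqrt_1; lra.
Qed.

(** The inductive step for the boundary inequality: [a] and [b] are the measures of the two halves,
    and [2 * (a - b) ^ 2] comes from points of the larger half with an outer neighbour across. *)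
Lemma profile_two_point a b : (0 <= b <= a -> a <= 1 ->
  2 * profile ((a + b) / 2) <= sqrt (profile a ^ 2 + 2 * (a - b) ^ 2) + profile b)%R.
Proof.
move=> [b0 ba] a1.
have [a0|a0] : (0 < a \/ a = 0)%R by lra.
  2: by have -> : b = 0%R; [lra | rewrite a0 /profile;
     have := sqrt_pos ((0 * (sqrt (1 - ln 0) - 1)) ^ 2 + 2 * (0 - 0) ^ 2);
     rewrite (_ : (0 + 0) / 2 = 0)%R; [lra | field]].
set m := ((a + b) / 2)%R.
have m0 : (0 < m)%R by rewrite /m; lra.
have lna := @ln_le1 a (conj a0 a1).
have pa := @profile_ge0 a (conj (Rlt_le _ _ a0) a1).
suff main : (2 * (m * sqrt (1 - ln m)) - b * sqrt (1 - ln b) <=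
    sqrt (a ^ 2 * (1 - ln a) + 2 * (a - b) ^ 2))%R.
  have tri : (sqrt (a ^ 2 * (1 - ln a) + 2 * (a - b) ^ 2) <=
      sqrt (profile a ^ 2 + 2 * (a - b) ^ 2) + a)%R.
    set s := sqrt (profile a ^ 2 + _).
    have s0 : (0 <= s)%R by apply: sqrt_pos.
    have ss : (s ^ 2 = profile a ^ 2 + 2 * (a - b) ^ 2)%R.
      by rewrite /s pow2_sqrt //; nra.
    have ps : (profile a <= s)%R by apply: le_sqrt_sq; nra.
    rewrite -(sqrt_pow2 (s + a)); last lra.
    apply: sqrt_le_1_alt.
    have -> : (a ^ 2 * (1 - ln a) = (profile a + a) ^ 2)%R.
      have -> : (profile a + a = a * sqrt (1 - ln a))%R by rewrite /profile; ring.
      by rewrite Rpow_mult_distr pow2_sqrt //; lra.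
    nra.
  have -> : profile m = (m * sqrt (1 - ln m) - m)%R by rewrite /profile; ring.
  have -> : profile b = (b * sqrt (1 - ln b) - b)%R by rewrite /profile; ring.
  have : (2 * m = a + b)%R by rewrite /m; field.
  lra.
apply: le_sqrt_sq.
case: b0 => [b0|b0].
  pose r := ((a - b) / (a + b))%R.
  have ar : (a = m * (1 + r))%R by rewrite /m /r; field; lra.
  have br : (b = m * (1 - r))%R by rewrite /m /r; field; lra.
  have r0 : (0 <= r)%R by apply: Rmult_le_pos; [lra | apply/Rlt_le/Rinv_0_lt_compat; lra].
  have r1 : (r < 1)%R by nra.
  have lnm := @ln_le1 m ltac:(rewrite /m; lra).
  have E1 := @ln_diff_le m a m0 a0.
  have E2 := @ln_diff_le m b m0 b0.
  have E3 := @ln_diff_le b m b0 m0.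
  have e1 : ((a - m) / m = r)%R by rewrite /m /r; field; lra.
  have e2 : ((b - m) / m = - r)%R by rewrite /m /r; field; lra.
  have e3 : ((m - b) / b * (1 - r) = r)%R by rewrite /m /r; field; lra.
  have := @two_point_core r (sqrt (1 - ln m)) (sqrt (1 - ln b)) (1 - ln a).
  rewrite !pow2_sqrt; try lra.
  move=> /(_ (conj r0 r1)) core.
  have {}core := core _ ltac:(lra) ltac:(lra) ltac:(nra).
  have : (1 <= sqrt (1 - ln m) <= sqrt (1 - ln b))%R.
    split; first by apply: le_sqrt_sq; lra.
    by apply: sqrt_le_1_alt; lra.
  move=> /core {}core.
  set P := sqrt (1 - ln m) in core *; set Q := sqrt (1 - ln b) in core *.
  have -> : (2 * (m * P) - b * Q = m * ((1 + r) * P - (1 - r) * (Q - P)))%R.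
    by rewrite {1}br; ring.
  have -> : (a ^ 2 * (1 - ln a) + 2 * (a - b) ^ 2 =
      m ^ 2 * ((1 + r) ^ 2 * (1 - ln a) + 8 * r ^ 2))%R.
    have -> : (a - b = 2 * m * r)%R by rewrite {1}ar {1}br; ring.
    by rewrite {1}ar; ring.
  rewrite Rpow_mult_distr; apply: Rmult_le_compat_l => //; nra.
(* When [b = 0] the squared claim reduces to [ln 2 <= 2]. *)
rewrite /m -b0 Rplus_0_r !Rmult_0_l !Rminus_0_r.
have l2 : (ln (a / 2) = ln a - ln 2)%R.
  by rewrite /Rdiv ln_mult ?ln_Rinv; try lra.
have := @ln_le_sub1 2 ltac:(lra) => ln2.
have ln20 : (0 < ln 2)%R by rewrite -ln_1; apply: ln_increasing; lra.
have -> : (2 * (a / 2 * sqrt (1 - ln (a / 2))) = a * sqrt (1 - ln (a / 2)))%R by field.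
by rewrite Rpow_mult_distr pow2_sqrt l2; nra.
Qed.

(** * Normalised integrals, measure and Minkowski's inequality *)

Lemma pow2_gt0 n : (0 < 2 ^ n)%R.
Proof. by apply: pow_lt; lra. Qed.

Lemma Rdiv_le_r x y c : (0 < c -> x <= y -> x / c <= y / c)%R.
Proof. by move=> c0 xy; apply: Rmult_le_compat_r => //; apply/Rlt_le/Rinv_0_lt_compat. Qed.

Lemma integral_le n (F G : cube n -> R) :
  (forall x, (F x <= G x)%R) -> (integral F <= integral G)%R.
Proof. by move=> H; apply: Rdiv_le_r; [exact: pow2_gt0 | exact: rsum_le]. Qed.

Lemma integral_ge0 n (F : cube n -> R) : (forall x, (0 <= F x)%R) -> (0 <= integral F)%R.
Proof.
move=> H; apply: Rmult_le_pos; first exact: rsum_ge0.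
exact/Rlt_le/Rinv_0_lt_compat/pow2_gt0.
Qed.

Lemma eq_integral n (F G : cube n -> R) : F =1 G -> integral F = integral G.
Proof. by move=> H; rewrite /integral; congr Rdiv; apply: eq_bigr. Qed.

Lemma integralD n (F G : cube n -> R) :
  integral (fun x => F x + G x)%R = (integral F + integral G)%R.
Proof. by rewrite /integral big_split /=; apply: Rmult_plus_distr_r. Qed.

Lemma integralZ n c (F : cube n -> R) : integral (fun x => c * F x)%R = (c * integral F)%R.
Proof. by rewrite /integral -big_distrr /= /Rdiv Rmult_assoc. Qed.

Lemma muE n (A : {set cube n}) : mu A = integral (fun x => INR (x \in A)).
Proof. by rewrite /mu /integral INR_card. Qed.

Lemma integral_cons n (F : cube n.+1 -> R) :
  integral F =
  ((integral (fun x => F (cons true x)) + integral (fun x => F (cons false x))) / 2)%R.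
Proof.
have half (a b N : R) : (0 < N -> (a + b) / (2 * N) = (a / N + b / N) / 2)%R.
  by move=> N0; field; lra.
rewrite /integral big_cons_cube; exact: half (pow2_gt0 n).
Qed.

Lemma mu_slice n (S : {set cube n.+1}) : mu S = ((mu (slice true S) + mu (slice false S)) / 2)%R.
Proof.
rewrite !muE integral_cons.
by congr ((_ + _) / 2)%R; apply: eq_integral => x; rewrite in_slice.
Qed.

Lemma mu_ge0 n (S : {set cube n}) : (0 <= mu S)%R.
Proof. by rewrite muE; apply: integral_ge0 => x; exact: pos_INR. Qed.

Lemma INR_expn n : INR (2 ^ n) = (2 ^ n)%R.
Proof. by elim: n => //= n IHn; rewrite expnS mult_INR IHn. Qed.

Lemma mu_le1 n (S : {set cube n}) : (mu S <= 1)%R.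
Proof.
have N := pow2_gt0 n; rewrite /mu -(Rinv_r (2 ^ n)); last lra.
apply: Rdiv_le_r => //; rewrite -INR_expn; apply: INR_leq.
by rewrite -card_cube; exact: max_card.
Qed.

(** Minkowski for the plane vectors [(p x, q x)]: project each onto the unit vector [(c, s)] along
    their sum; a projection is no longer than the vector. *)
Lemma sqrt_sum_le (I : finType) (p q : I -> R) :
  (sqrt ((\rsum_x p x) ^ 2 + (\rsum_x q x) ^ 2) <= \rsum_x sqrt (p x ^ 2 + q x ^ 2))%R.
Proof.
set P := (\rsum_x p x)%R; set Q := (\rsum_x q x)%R; set r := sqrt _.
have r2 : (r ^ 2 = P ^ 2 + Q ^ 2)%R by rewrite pow2_sqrt //; nra.
have [r0|<-] : (0 < r \/ 0 = r)%R by exact: sqrt_pos.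
  2: by apply: rsum_ge0 => x _; exact: sqrt_pos.
pose c := (P / r)%R; pose s := (Q / r)%R.
have cs : (c ^ 2 + s ^ 2 = 1)%R.
  have -> : (c ^ 2 + s ^ 2 = (P ^ 2 + Q ^ 2) / r ^ 2)%R by rewrite /c /s; field; lra.
  by rewrite -r2; field; lra.
have -> : (r = \rsum_x (c * p x + s * q x))%R.
  rewrite big_split -!big_distrr /= -/P -/Q.
  apply: (Rmult_eq_reg_r r); last lra.
  have -> : ((c * P + s * Q) * r = P ^ 2 + Q ^ 2)%R by rewrite /c /s; field; lra.
  by rewrite -r2; ring.
apply: rsum_le => x _; apply: le_sqrt_sq.
have := pow2_ge_0 (c * q x - s * p x).
have : ((c ^ 2 + s ^ 2) * (p x ^ 2 + q x ^ 2) = p x ^ 2 + q x ^ 2)%R by rewrite cs; ring.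
lra.
Qed.

Lemma integral_sqrt_le n (p q : cube n -> R) :
  (sqrt (integral p ^ 2 + integral q ^ 2) <= integral (fun x => sqrt (p x ^ 2 + q x ^ 2)))%R.
Proof.
have N := pow2_gt0 n.
rewrite /integral; set P := (\rsum_x p x)%R; set Q := (\rsum_x q x)%R.
have -> : ((P / 2 ^ n) ^ 2 + (Q / 2 ^ n) ^ 2 = (P ^ 2 + Q ^ 2) / (2 ^ n) ^ 2)%R by field; lra.
rewrite sqrt_div_alt ?sqrt_pow2; try nra.
by apply: Rdiv_le_r => //; exact: sqrt_sum_le.
Qed.

Lemma mu_setD n (S T : {set cube n}) : (mu S - mu T <= mu (S :\: T))%R.
Proof.
suff : (mu S <= mu (S :\: T) + mu T)%R by lra.
rewrite !muE -integralD; apply: integral_le => x.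
by rewrite !inE; case: (x \in S); case: (x \in T) => /=; lra.
Qed.

(* Induction on [n]: in the larger half, at least [a - b] of the measure has one more outer neighbour, and Minkowski's
   inequality reduces the claim to [profile_two_point]. *)
Lemma sqrt_boundary_profile n (S : {set cube n}) :
  (profile (mu S) <= integral (fun x => sqrt (2 * INR (hS S x))))%R.
Proof.
elim: n S => [|n IHn] S.
  have -> : profile (mu S) = 0%R.
    rewrite /profile.
    have : #|S| <= 1 by have := max_card S; rewrite card_cube.
    have -> : mu S = INR #|S| by rewrite /mu /=; field.
    case: #|S| => [|[|//]] _ /=; first by rewrite Rmult_0_l.
    by rewrite ln_1 Rminus_0_r sqrt_1; ring.
  by apply: integral_ge0 => x; exact: sqrt_pos.
pose half b := integral (fun x => sqrt (2 * INR (hS S (cons b x)))).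
have half_ge b : (mu (slice (~~ b) S) <= mu (slice b S) ->
   sqrt (profile (mu (slice b S)) ^ 2 + 2 * (mu (slice b S) - mu (slice (~~ b) S)) ^ 2) <= half b)%R.
  move=> le.
  have dm := mu_setD (slice b S) (slice (~~ b) S).
  have IH := IHn (slice b S).
  have P0 : (0 <= profile (mu (slice b S)))%R.
    by apply: profile_ge0; split; [exact: mu_ge0 | exact: mu_le1].
  set D := slice b S :\: slice (~~ b) S in dm.
  pose q x := (sqrt 2 * INR (x \in D))%R.
  apply: Rle_trans (_ : sqrt (integral (fun x => sqrt (2 * INR (hS (slice b S) x))) ^ 2 +
    integral q ^ 2) <= _)%R.
    apply: sqrt_le_1_alt; rewrite integralZ -muE Rpow_mult_distr pow2_sqrt; last lra.
    nra.
  apply: Rle_trans (integral_sqrt_le _ _) _.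
  apply: integral_le => x; apply: sqrt_le_1_alt; rewrite /q.
  have h0 := pos_INR (hS (slice b S) x).
  rewrite Rpow_mult_distr !pow2_sqrt; try lra.
  rewrite /hS deg_cons !slice_setC /D in_setD !in_slice in_setC in_slice.
  rewrite !(fun_if INR) INR_addn.
  case: (cons b x \in S); case: (cons (~~ b) x \in S) => /=; lra.
(* On the smaller half the edges across are simply discarded. *)
have half_ge' b : (profile (mu (slice b S)) <= half b)%R.
  apply: Rle_trans (IHn _) _; apply: integral_le => x; apply: sqrt_le_1_alt.
  apply: Rmult_le_compat_l; first lra.
  apply: INR_leq; rewrite /hS in_slice deg_cons !slice_setC.
  by case: ifP => // _; exact: leq_addl.
rewrite integral_cons -/(half true) -/(half false) mu_slice.
have b01 b : (0 <= mu (slice b S) <= 1)%R by split; [exact: mu_ge0 | exact: mu_le1].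
have [T0 T1] := b01 true; have [F0 F1] := b01 false.
case: (Rle_lt_dec (mu (slice false S)) (mu (slice true S))) => [|/Rlt_le] le.
  have := profile_two_point (conj F0 le) T1.
  have := half_ge true le; have := half_ge' false; rewrite /=; lra.
rewrite (Rplus_comm (mu (slice true S))).
have := profile_two_point (conj T0 le) F1.
have := half_ge false le; have := half_ge' true; rewrite /=; lra.
Qed.

Definition edge_density n (A B : {set cube n}) : R := (INR (edge_bd A B) / 2 ^ n)%R.

Lemma edge_densityE n (A B : {set cube n}) :
  edge_density A B = integral (fun x => if x \in A then INR (deg B x) else 0%R).
Proof.
by rewrite /edge_density edge_bdE INR_sum /integral; congr Rdiv; rewrite big_mkcond.
Qed.

(* Small sets expand: [profile] is superlinear at 0, and every vertex of [W] sends out at most [n] edges. *)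
Lemma small_set_expansion (L : R) : (0 < L)%R -> exists eta, (0 < eta)%R /\
  forall n (S W : {set cube n}), [disjoint S & W] -> (mu (S :|: W) <= eta)%R ->
  (L * mu (S :|: W) <= edge_density S (~: (S :|: W)) + sqrt (INR n) * mu W)%R.
Proof.
(* Below this measure [sqrt (1 - ln t)] is at least [1 + 2 * L], so [profile t] is at least
   [2 * L * t]. *)
move=> L0; exists (exp (- (1 + 2 * L) ^ 2)); split; first exact: exp_pos.
move=> n S W dSW small; set T := S :|: W in small *.
have prof : (2 * L * mu T <= profile (mu T))%R.
  rewrite /profile; case: (mu_ge0 T) => [T0|<-]; last lra.
  have : (ln (mu T) <= - (1 + 2 * L) ^ 2)%R.
    rewrite -(ln_exp (- _)%R); case: small => [lt|->]; last lra.
    exact/Rlt_le/ln_increasing.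
  move=> lnT; have : (1 + 2 * L <= sqrt (1 - ln (mu T)))%R by apply: le_sqrt_sq; lra.
  nra.
suff : (integral (fun x => sqrt (2 * INR (hS T x))) <=
    2 * (edge_density S (~: T) + sqrt (INR n) * mu W))%R.
  by have := sqrt_boundary_profile T; lra.
rewrite edge_densityE muE -integralZ.
rewrite -integralD -integralZ; apply: integral_le => x.
have sq2 d : (sqrt (2 * d) <= 2 * sqrt d)%R.
  rewrite sqrt_mult_alt; last lra.
  have := sqrt_pos d; have : (sqrt 2 <= 2)%R; last nra.
  by rewrite -{2}(sqrt_pow2 2); [apply: sqrt_le_1_alt; lra | lra].
apply: Rle_trans (sq2 _) _; apply: Rmult_le_compat_l; first lra.
rewrite /hS /T in_setU.
have [xS|xS] /= := boolP (x \in S).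
  rewrite (disjointFr dSW xS) Rmult_0_r Rplus_0_r.
  (* A natural number dominates its square root, so on [S] the integrand is bounded by an edge
     count. *)
  set d := deg _ _; case: d => [|d]; first by rewrite sqrt_0; exact: Rle_refl.
  have d1 : (1 <= INR d.+1)%R by rewrite S_INR; have := pos_INR d; lra.
  rewrite -{2}(sqrt_pow2 (INR d.+1)); last lra.
  by apply: sqrt_le_1_alt; nra.
case: ifP => xW; last by rewrite sqrt_0 /=; lra.
rewrite /= Rmult_1_r Rplus_0_l; apply: sqrt_le_1_alt; apply: INR_leq.
exact: deg_le.
Qed.

(** * Growth of f *)

Lemma bin_le_half n r : 'C(n, r) <= 'C(n, n./2).
Proof.
have up j : j <= n./2 -> 'C(n, n./2 - j) <= 'C(n, n./2).
  elim: j => [|j IHj] jn; first by rewrite subn0.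
  apply: leq_trans (IHj (ltnW jn)).
  have -> : n./2 - j = (n./2 - j.+1).+1 by lia.
  set i := n./2 - j.+1.
  have := mul_bin_left n i; have : i.+1 <= n - i by rewrite /i; lia.
  move=> le E; rewrite -(leq_pmul2l (ltn0Sn i)) E.
  by rewrite leq_mul2r le orbT.
have [rn|rn] := leqP r n./2.
  by have := up (n./2 - r); rewrite subKn //; apply; exact: leq_subr.
have [nr|nr] := ltnP n r; first by rewrite bin_small.
rewrite -bin_sub //; have := up (n./2 - (n - r)); rewrite subKn; last by lia.
by apply; exact: leq_subr.
Qed.

(** Induction through the ratio of consecutive central coefficients, using
    [(2m+1)(2m+3) <= (2m+2)^2]. *)
Lemma central_bin_le m : 'C(m.*2, m) ^ 2 * m.*2.+1 <= 4 ^ m.*2.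
Proof.
elim: m => // m IHm.
have E : 'C(m.+1.*2, m.+1) * m.+1 = 'C(m.*2, m) * (2 * m.*2.+1).
  have e1 := mul_bin_diag m.*2.+2 m.
  have e2 := mul_bin_down m.*2.+1 m.
  have h : m.*2.+1 - m = m.+1 by lia.
  rewrite /= in e1 e2; rewrite h in e2.
  by rewrite doubleS mulnC -e1 -doubleS -mul2n -mulnA -e2 [RHS]mulnC -mulnA.
have : ('C(m.+1.*2, m.+1) * m.+1) ^ 2 * m.+1.*2.+1 <= 4 ^ m.+1.*2 * m.+1 ^ 2.
  have -> : 4 ^ m.+1.*2 * m.+1 ^ 2 = 4 ^ m.*2 * (16 * m.+1 ^ 2).
    by rewrite doubleS !expnS !mulnA; congr (_ * _ * _); lia.
  have -> : ('C(m.+1.*2, m.+1) * m.+1) ^ 2 * m.+1.*2.+1 =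
      'C(m.*2, m) ^ 2 * m.*2.+1 * (4 * (m.*2.+1 * m.*2.+3)).
    by rewrite E doubleS; set C := 'C(_, _); set D := m.*2; lia.
  by apply: leq_mul => //; rewrite -muln2; lia.
by rewrite expnMn mulnAC leq_pmul2r // expn_gt0.
Qed.

(** The bound [2^n / sqrt (n+1)] in squared form. For odd [n] the middle coefficient is half of the
    next even central one. *)
Lemma bin_sqrt_bound n r : 'C(n, r) ^ 2 * n.+1 <= 4 ^ n.
Proof.
apply: leq_trans (_ : 'C(n, n./2) ^ 2 * n.+1 <= _).
  by rewrite leq_mul2r leq_sqr bin_le_half orbT.
rewrite -(odd_double_half n); case: (odd n) => /=; last first.
  by rewrite add0n doubleK; exact: central_bin_le.
set m := n./2; rewrite add1n uphalf_double.
have E : 'C(m.+1.*2, m.+1) = 2 * 'C(m.*2.+1, m).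
  rewrite doubleS binS (_ : 'C(m.*2.+1, m.+1) = 'C(m.*2.+1, m)) ?addnn ?mul2n //.
  by rewrite -[RHS]bin_sub; [congr 'C(_, _) | ]; lia.
have := central_bin_le m.+1; rewrite E doubleS expnMn !expnS.
by set C := 'C(_, _); lia.
Qed.

Definition weight n (x : cube n) : nat := #|[set i | x i]|.

Lemma card_layer n r : #|[set x : cube n | weight x == r]| = 'C(n, r).
Proof.
rewrite -[in RHS](card_ord n) -card_draws.
have inj : injective (fun x : cube n => [set i | x i]).
  by move=> x y /setP E; apply/ffunP => i; have := E i; rewrite !inE.
rewrite -(card_imset _ inj); apply: eq_card => A; rewrite inE.
apply/imsetP/idP => [[x + ->]|cA]; first by rewrite inE.
exists [ffun i => i \in A]; last by apply/setP => i; rewrite inE ffunE.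
by rewrite inE /weight -(eqP cA); apply/eqP/eq_card => i; rewrite inE ffunE.
Qed.

Lemma weight_flip n (x : cube n) i : weight (flip x i) <= (weight x).+1.
Proof.
apply: leq_trans (subset_leq_card (_ : _ \subset i |: [set j | x j])) _.
  by apply/subsetP => j; rewrite !inE flipE; case: (x j); case: eqP.
by rewrite cardsU1 -add1n leq_add2r; case: (_ \notin _).
Qed.

Definition ball n r : {set cube n} := [set x | weight x <= r].

(** Only the outermost layer of a ball meets the complement, since a flip raises the weight by at
    most one. *)
Lemma hS_ball n r x : weight x != r -> hS (ball n r) x = 0.
Proof.
move=> xr; rewrite /hS inE; case: ifP => // le; apply/eqP.
rewrite degE sum_nat_eq0; apply/forall_inP => i _; rewrite !inE.
by rewrite eqb0 negbK (leq_trans (weight_flip x i)) // ltn_neqAle xr.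
Qed.

(** Take the least radius at which the measure reaches [2^-k]; without its outermost layer the ball
    has measure at most [2^-k]. *)
Lemma ball_near n k : exists r,
  (/ 2 ^ k <= mu (ball n r) <= / 2 ^ k + INR 'C(n, r) / 2 ^ n)%R.
Proof.
have N := pow2_gt0 n; have K := pow2_gt0 k.
have exr : exists r, 2 ^ n <= #|ball n r| * 2 ^ k.
  exists n; have -> : ball n n = setT.
    by apply/setP => x; rewrite !inE /weight -[X in _ <= X]card_ord max_card.
  by rewrite cardsT card_cube leq_pmulr // expn_gt0.
case: (ex_minnP exr) => r /INR_leq + minr.
rewrite INR_muln !INR_expn => ge; exists r; split.
  apply: (Rmult_le_reg_r (2 ^ k)) => //; rewrite Rinv_l; last lra.
  apply: (Rmult_le_reg_r (2 ^ n)) => //.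
  have -> : (mu (ball n r) * 2 ^ k * 2 ^ n = INR #|ball n r| * 2 ^ k)%R.
    by rewrite /mu; field; lra.
  lra.
pose low : {set cube n} := [set x | weight x < r].
have layer : #|ball n r| = #|low| + 'C(n, r).
  rewrite -(card_layer n r) -cardsUI [X in _ + X](_ : _ = 0) ?addn0.
    by apply: eq_card => x; rewrite !inE leq_eqVlt orbC.
  by apply/eqP; rewrite cards_eq0; apply/eqP/setP => x; rewrite !inE ltn_neqAle; case: eqP; rewrite ?andbF.
have lt : (INR #|low| * 2 ^ k <= 2 ^ n)%R.
  rewrite -!INR_expn -INR_muln; apply: INR_leq.
  rewrite /low; case: r {ge layer low} minr => [|r] minr.
    by rewrite (_ : [set _ | _] = set0) ?cards0 //; apply/setP => x; rewrite !inE.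
  rewrite leqNgt; apply/negP => /ltnW /minr; suff: ~~ (r.+1 <= r) by move/negP. 
  by rewrite ltnn.
rewrite /mu layer INR_addn /Rdiv Rmult_plus_distr_r; apply: Rplus_le_compat_r.
apply: (Rmult_le_reg_r (2 ^ k)) => //; rewrite Rinv_l; last lra.
apply: (Rmult_le_reg_r (2 ^ n)) => //; rewrite Rmult_1_l.
set c := INR _ in lt *; have -> : (c * / 2 ^ n * 2 ^ k * 2 ^ n = c * 2 ^ k)%R by field; lra.
exact: lt.
Qed.

(** The boundary points of a ball of measure near [2^-k] lie in one layer, of measure at most
    [1 / sqrt n], and each contributes at most [f n]. By continuity of [g] the integral is at least
    half of [k 2^-k]. *)
Lemma sqrt_growth k (f g : R -> R) :
  (0 < k)%N ->
  (forall x, (0 <= x <= 1)%R -> forall eps, (0 < eps)%R ->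
     exists delta, (0 < delta)%R /\
       forall y, (0 <= y <= 1)%R -> (Rabs (y - x) < delta)%R ->
         (Rabs (g y - g x) < eps)%R) ->
  g (/ 2 ^ k)%R = (INR k / 2 ^ k)%R ->
  (forall x, (0 <= x)%R -> (0 <= f x)%R) ->
  (forall x y, (0 <= x)%R -> (x < y)%R -> (f x < f y)%R) ->
  f 0%R = 0%R ->
  (forall (n : nat) (A : {set cube n}), (1 <= n)%N ->
     (g (mu A) <= integral (fun x => f (INR (hS A x))))%R) ->
  exists c, (0 < c)%R /\ forall n, (1 <= n)%N -> (c * sqrt (INR n) <= f (INR n))%R.
Proof.
move=> k0 gC gk f_ge0 f_inc f0 iso.
have K := pow2_gt0 k; have kR : (1 <= INR k)%R by apply: (INR_leq k0).
pose e := (INR k / 2 ^ k / 2)%R.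
have e0 : (0 < e)%R by rewrite /e; apply: Rdiv_lt_0_compat; [apply: Rdiv_lt_0_compat|]; lra.
have K01 : (0 <= / 2 ^ k <= 1)%R.
  split; first exact/Rlt_le/Rinv_0_lt_compat.
  rewrite -Rinv_1; apply: Rinv_le_contravar; first lra.
  by apply: pow_R1_Rle; lra.
have [d [d0 Hd]] := gC _ K01 e e0.
have f1 : (0 < f 1)%R by rewrite -f0; apply: f_inc; lra.
exists (Rmin e (f 1 * d))%R; split; first by apply: Rmin_pos => //; nra.
move=> n n1; have nR : (1 <= INR n)%R by apply: (INR_leq n1).
set s := sqrt (INR n); have s1 : (1 <= s)%R by apply: le_sqrt_sq; lra.
have ss : (s ^ 2 = INR n)%R by rewrite pow2_sqrt //; lra.
(* For small [n] the ball may miss [2^-k] by [d] or more; there [f 1 <= f n] suffices. *)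
case: (Rle_lt_dec (s * d) 1) => sd.
  have : (f 1 <= f (INR n))%R.
    by case: nR => [lt|<-]; [apply/Rlt_le/f_inc; lra | exact: Rle_refl].
  have := Rmin_r e (f 1 * d)%R; nra.
have [r [b1 b2]] := ball_near n k.
have N := pow2_gt0 n.
set C := INR 'C(n, r) in b2.
have C0 : (0 <= C)%R by exact: pos_INR.
have Cs : (C * s <= 2 ^ n)%R.
  have := INR_leq (bin_sqrt_bound n r).
  rewrite -mulnn !INR_muln S_INR -/C => H.
  have E4 : INR (4 ^ n) = (2 ^ n * 2 ^ n)%R by rewrite -INR_expn -INR_muln -expnMn.
  rewrite E4 in H.
  have : ((C * s) ^ 2 <= (2 ^ n) ^ 2)%R by rewrite Rpow_mult_distr ss; nra.
  by move=> sq; apply: Rsqr_incr_0_var; [rewrite !Rsqr_pow2 | lra].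
have Cd : (C / 2 ^ n < d)%R.
  apply: (Rmult_lt_reg_r (2 ^ n)) => //.
  have -> : (C / 2 ^ n * 2 ^ n = C)%R by field; lra.
  nra.
have := Hd (mu (ball n r)) (conj (mu_ge0 _) (mu_le1 _)).
rewrite Rabs_pos_eq; last lra.
move=> /(_ ltac:(lra)) /Rabs_def2 [_]; rewrite gk => g_low.
have := iso n (ball n r) n1 => up.
have : (integral (fun x => f (INR (hS (ball n r) x))) <= f (INR n) * (C / 2 ^ n))%R.
  rewrite /C -card_layer -[(_ / 2 ^ n)%R]/(mu _) muE -integralZ; apply: integral_le => x.
  rewrite inE; case: eqP => [_|/eqP xr]; last by rewrite hS_ball //= f0; lra.
  rewrite /= Rmult_1_r; have : hS (ball n r) x <= n by rewrite /hS; case: ifP => // _; exact: deg_le.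
  move=> /INR_leq [lt|->]; last exact: Rle_refl.
  by apply/Rlt_le/f_inc => //; exact: pos_INR.
move=> up2; have em := Rmin_l e (f 1 * d)%R.
have fe : (e <= f (INR n) * (C / 2 ^ n))%R by rewrite /e in g_low *; lra.
have Cs' : (C / 2 ^ n * s <= 1)%R.
  apply: (Rmult_le_reg_r (2 ^ n)) => //.
  have -> : (C / 2 ^ n * s * 2 ^ n = C * s)%R by field; lra.
  lra.
have fn := f_ge0 (INR n) ltac:(lra).
apply: Rle_trans (_ : e * s <= _)%R; first by apply: Rmult_le_compat_r; lra.
apply: Rle_trans (_ : f (INR n) * (C / 2 ^ n) * s <= _)%R; first by apply: Rmult_le_compat_r; lra.
nra.
Qed.

(** * Rigidity *)

Definition strictly_concave (f : R -> R) : Prop :=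
  forall x y t, (0 <= x)%R -> (0 <= y)%R -> x <> y -> (0 < t < 1)%R ->
     (t * f x + (1 - t) * f y < f (t * x + (1 - t) * y))%R.

Lemma concave_chord f x y l : strictly_concave f ->
  (0 <= x -> 0 <= y -> x <> y -> 0 < l <= 1 ->
   l * (f y - f x) <= f (x + l * (y - x)) - f x)%R.
Proof.
move=> fC x0 y0 xy [l0 [l1|->]]; last first.
  by have -> : (x + 1 * (y - x) = y)%R; [ring | lra].
have := fC x y (1 - l)%R x0 y0 xy ltac:(lra).
have -> : ((1 - l) * x + (1 - (1 - l)) * y = x + l * (y - x))%R by ring.
lra.
Qed.

(* [s] is the slope of a supporting line of [f] at [k]; on integers the concavity gap is linear in the distance
   to [k]. *)
Lemma concave_gap k f : (0 < k)%N -> strictly_concave f ->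
  (forall x y, (0 <= x)%R -> (x < y)%R -> (f x < f y)%R) ->
  f (INR k) = INR k ->
  exists s c, (0 <= s)%R /\ (0 < c)%R /\ forall d : nat,
    (f (INR d) <= INR k + s * (INR d - INR k) - c * Rabs (INR d - INR k))%R.
Proof.
move=> k0 fC f_inc fk; have kR : (1 <= INR k)%R by apply: (INR_leq k0).
(* The slopes of the unit chords on the two sides of [k]. Their mean serves as [s] and half their
   difference as [c]. *)
pose a := (f (INR k) - f (INR k - 1))%R; pose b := (f (INR k + 1) - f (INR k))%R.
have ab : (b < a)%R.
  have := fC (INR k - 1)%R (INR k + 1)%R (/ 2)%R ltac:(lra) ltac:(lra) ltac:(lra) ltac:(lra).
  have -> : (/ 2 * (INR k - 1) + (1 - / 2) * (INR k + 1) = INR k)%R by field.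
  rewrite /a /b; lra.
have b0 : (0 < b)%R by have := f_inc (INR k) (INR k + 1)%R ltac:(lra) ltac:(lra); rewrite /b; lra.
exists ((a + b) / 2)%R, ((a - b) / 2)%R; split; [lra | split; [lra | move=> d]].
have dR := pos_INR d.
have [lt|[->|lt]] : (d < k \/ d = k \/ k < d)%N by lia.
- have dk : (INR d + 1 <= INR k)%R by rewrite -S_INR; apply: INR_leq.
  have kd : (0 < / (INR k - INR d) <= 1)%R.
    split; first by apply: Rinv_0_lt_compat; lra.
    by rewrite -Rinv_1; apply: Rinv_le_contravar; lra.
  have := @concave_chord f (INR k) (INR d) _ fC ltac:(lra) dR ltac:(lra) kd.
  have -> : (INR k + / (INR k - INR d) * (INR d - INR k) = INR k - 1)%R by field; lra.
  move/(Rmult_le_compat_l (INR k - INR d) _ _ ltac:(lra)).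
  rewrite -Rmult_assoc Rinv_r ?Rmult_1_l; last lra.
  rewrite Rabs_left; last lra.
  by rewrite /a /b in ab b0 *; nra.
- rewrite Rminus_diag Rabs_R0 fk; lra.
- have dk : (INR k + 1 <= INR d)%R by rewrite -S_INR; apply: INR_leq.
  have kd : (0 < / (INR d - INR k) <= 1)%R.
    split; first by apply: Rinv_0_lt_compat; lra.
    by rewrite -Rinv_1; apply: Rinv_le_contravar; lra.
  have := @concave_chord f (INR k) (INR d) _ fC ltac:(lra) dR ltac:(lra) kd.
  have -> : (INR k + / (INR d - INR k) * (INR d - INR k) = INR k + 1)%R by field; lra.
  move/(Rmult_le_compat_l (INR d - INR k) _ _ ltac:(lra)).
  rewrite -Rmult_assoc Rinv_r ?Rmult_1_l; last lra.
  rewrite Rabs_right; last lra.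
  by rewrite /a /b in ab b0 *; nra.
Qed.

Definition deviation n k (S T : {set cube n}) : R :=
  integral (fun x => if x \in S then Rabs (INR (deg T x) - INR k) else 0%R).

(** Integrating the concavity gap bounds the integral of [f(h)] above by a linear expression minus
    [c] times the deviation, with at most [f n] per point of [W]; the hypothesis and continuity of
    [g] bound it below. [s] and [c] are fixed before [w], so an expansion constant can be built from
    them first. *)
Lemma deviation_rigidity k (f g : R -> R) :
  (0 < k)%N ->
  (forall x, (0 <= x <= 1)%R -> forall eps, (0 < eps)%R ->
     exists delta, (0 < delta)%R /\
       forall y, (0 <= y <= 1)%R -> (Rabs (y - x) < delta)%R ->
         (Rabs (g y - g x) < eps)%R) ->
  g (/ 2 ^ k)%R = (INR k / 2 ^ k)%R ->
  (forall x y, (0 <= x)%R -> (x < y)%R -> (f x < f y)%R) ->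
  strictly_concave f ->
  f 0%R = 0%R ->
  f (INR k) = INR k ->
  (forall (n : nat) (A : {set cube n}), (1 <= n)%N ->
     (g (mu A) <= integral (fun x => f (INR (hS A x))))%R) ->
  exists s c, (0 <= s)%R /\ (0 < c)%R /\
  forall w, (0 < w)%R -> exists rho, (0 < rho)%R /\
  forall n (S W : {set cube n}), (1 <= n)%N -> [disjoint S & W] ->
    (Rabs (mu (S :|: W) - / 2 ^ k) <= rho)%R ->
    (c * deviation k S (~: (S :|: W)) <=
     s * (edge_density S (~: (S :|: W)) - INR k * mu S) + w + f (INR n) * mu W)%R.
Proof.
move=> k0 gC gk f_inc fC f0 fk iso.
have [s [c [s0 [c0 gap]]]] := concave_gap k0 fC f_inc fk.
have K := pow2_gt0 k; have kR : (1 <= INR k)%R by apply: (INR_leq k0).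
exists s, c; split=> //; split=> // w w0.
have K01 : (0 <= / 2 ^ k <= 1)%R.
  split; first exact/Rlt_le/Rinv_0_lt_compat.
  rewrite -Rinv_1; apply: Rinv_le_contravar; first lra.
  by apply: pow_R1_Rle; lra.
have [d [d0 Hd]] := gC _ K01 (w / 2)%R ltac:(lra).
have kw : (0 < w / 2 / INR k)%R by apply: Rdiv_lt_0_compat; lra.
exists (Rmin (d / 2) (w / 2 / INR k)); split; first by apply: Rmin_pos => //; lra.
move=> n S W n1 dSW near.
have near1 := Rle_trans _ _ _ near (Rmin_l _ _).
have near2 := Rle_trans _ _ _ near (Rmin_r _ _).
set T := S :|: W in near near1 near2 *.
have := Hd (mu T) (conj (mu_ge0 _) (mu_le1 _)) ltac:(lra).
move=> /Rabs_def2 [_]; rewrite gk => g_low.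
have up := iso n T n1.
have up2 : (integral (fun x => f (INR (hS T x))) <=
    INR k * mu S + s * (edge_density S (~: T) - INR k * mu S) - c * deviation k S (~: T)
    + f (INR n) * mu W)%R.
  have -> : (INR k * mu S + s * (edge_density S (~: T) - INR k * mu S)
     - c * deviation k S (~: T) + f (INR n) * mu W =
     (INR k - s * INR k) * mu S + s * edge_density S (~: T)
     + (- c) * deviation k S (~: T) + f (INR n) * mu W)%R by ring.
  rewrite !muE edge_densityE /deviation -!integralZ -!integralD.
  apply: integral_le => x; rewrite /hS /T in_setU.
  have [xS|xS] /= := boolP (x \in S).
    rewrite (disjointFr dSW xS) /=; have := gap (deg (~: (S :|: W)) x); lra.
  case: (x \in W) => /=; last by rewrite f0; lra.
  have := INR_leq (deg_le (~: (S :|: W)) x).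
  move=> [lt|->]; last by lra.
  by have := f_inc _ _ (pos_INR _) lt; lra.
have ST : (mu S <= mu T)%R.
  by rewrite !muE; apply: integral_le => x; rewrite /T in_setU; case: (x \in S);
     case: (x \in W) => /=; lra.
have kT : (INR k * mu T <= INR k / 2 ^ k + w / 2)%R.
  have : (mu T <= / 2 ^ k + w / 2 / INR k)%R by have := Rle_abs (mu T - / 2 ^ k); lra.
  move/(Rmult_le_compat_l (INR k) _ _ ltac:(lra)).
  have -> : (INR k * (/ 2 ^ k + w / 2 / INR k) = INR k / 2 ^ k + w / 2)%R by field; lra.
  done.
have : (INR k * mu S <= INR k * mu T)%R by apply: Rmult_le_compat_l; lra.
lra.
Qed.

(** * Translates of A *)

Lemma mu_le n (S T : {set cube n}) : S \subset T -> (mu S <= mu T)%R.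
Proof.
move=> ST; rewrite !muE; apply: integral_le => x.
by apply: INR_leq; have := subsetP ST x; case: (x \in S) => // ->.
Qed.

Lemma mu_setU n (S T : {set cube n}) : (mu (S :|: T) <= mu S + mu T)%R.
Proof.
rewrite !muE -integralD; apply: integral_le => x; rewrite in_setU -INR_addn.
by apply: INR_leq; case: (x \in S); case: (x \in T).
Qed.

Lemma mu_disjointU n (S T : {set cube n}) : [disjoint S & T] -> mu (S :|: T) = (mu S + mu T)%R.
Proof.
move=> dST; rewrite !muE -integralD; apply: eq_integral => x; rewrite in_setU -INR_addn.
congr INR; have [xS|] := boolP (x \in S); last by rewrite add0n.
by rewrite (disjointFr dST xS).
Qed.

Definition shift n (T : {set 'I_n}) (x : cube n) : cube n := [ffun j => x j (+) (j \in T)].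

Lemma shiftK n (T : {set 'I_n}) : involutive (shift T).
Proof. by move=> x; apply/ffunP => j; rewrite !ffunE addbK. Qed.

Lemma flip_shift n (T : {set 'I_n}) x i : flip (shift T x) i = shift T (flip x i).
Proof. by apply/ffunP => j; rewrite !flipE !ffunE; case: ifP => /eqP ji; rewrite addbAC ?addbT ?addbF. Qed.

Lemma integral_shift n (T : {set 'I_n}) (F : cube n -> R) :
  integral (fun x => F (shift T x)) = integral F.
Proof.
by rewrite /integral [in RHS](reindex_inj (inv_inj (shiftK T))).
Qed.

(** Only translates landing in [B] count; those landing in [W] are charged to [mu W]. *)
Definition escape n (A B : {set cube n}) T : {set cube n} := [set x in A | shift T x \in B].

Lemma mu_escapeC n (A B : {set cube n}) T : mu (escape A B T) = mu (escape B A T).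
Proof.
rewrite !muE -[LHS](integral_shift T); apply: eq_integral => x.
by rewrite !inE shiftK andbC.
Qed.

Definition join n (S1 S0 : {set cube n}) : {set cube n.+1} :=
  [set y : cube n.+1 | [ffun i => y (lift ord0 i)] \in (if y ord0 then S1 else S0)].

Lemma slice_join n b (S1 S0 : {set cube n}) : slice b (join S1 S0) = if b then S1 else S0.
Proof.
apply/setP => x; rewrite !inE cons0.
by rewrite (_ : [ffun i => _] = x) //; apply/ffunP => i; rewrite ffunE consS.
Qed.

Lemma in_join n b x (S1 S0 : {set cube n}) :
  (cons b x \in join S1 S0) = (x \in if b then S1 else S0).
Proof. by rewrite -in_slice slice_join. Qed.

Lemma mu_join n (S1 S0 : {set cube n}) : mu (join S1 S0) = ((mu S1 + mu S0) / 2)%R.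
Proof. by rewrite mu_slice !slice_join. Qed.

Lemma disjoint_setIP (T : finType) (A B : {set T}) :
  (forall x, x \in A -> x \in B -> False) -> [disjoint A & B].
Proof.
move=> H; apply/pred0P => x /=; apply/negP => /andP [xA xB]; exact: H xA xB.
Qed.

(* [Y] carries the union of [A] and its translate on one level and the intersection on the other; points that are in
   [W], or whose translate is, are set aside in [WY]. *)
Section Doubling.
Variables (n k : nat) (A B W : {set cube n}) (T : {set 'I_n}).
Hypotheses (dAB : [disjoint A & B]) (dAW : [disjoint A & W]) (dBW : [disjoint B & W]).
Hypothesis (ABW : A :|: B :|: W = setT).

Let W2 : {set cube n} := W :|: [set x | shift T x \in W].
Let N : {set cube n} := [set x | [&& x \notin W2, x \in A & shift T x \in A]].
Let O : {set cube n} := [set x | (x \notin W2) && ((x \in A) || (shift T x \in A))].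
Let N' := ~: (N :|: W2).
Let O' := ~: (O :|: W2).
Let V := escape A B T.
Let Y := join N O.
Let WY := join W2 W2.

Let inB x : (x \in B) = (x \notin A) && (x \notin W).
Proof.
have := in_setT x; rewrite -ABW !inE.
have [xA|xA] /= := boolP (x \in A); first by rewrite (disjointFr dAB xA).
have [xB|xB] /= := boolP (x \in B); first by rewrite (disjointFr dBW xB).
by move=> ->.
Qed.

Let inW x : x \in W -> x \in A = false.
Proof. by move=> xW; apply: (disjointFl dAW). Qed.

Lemma mu_W2 : (mu W2 <= 2 * mu W)%R.
Proof.
have := mu_setU W [set x | shift T x \in W].
suff -> : mu [set x | shift T x \in W] = mu W by rewrite -/W2; lra.
rewrite !muE -[RHS](integral_shift T); apply: eq_integral => x; by rewrite inE.
Qed.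

Lemma disjoint_double : [disjoint Y & WY].
Proof.
apply: disjoint_setIP => y; rewrite (consP y) !in_join.
by case: (y ord0); rewrite !in_set => /andP [/negbTE ->].
Qed.

(** Off [W2], intersection and union together count a point as often as [A] and its translate do. *)
Lemma mu_double : (mu A - mu W2 <= mu Y <= mu A)%R.
Proof.
have -> : (mu A = (mu A + mu [set x | shift T x \in A]) / 2)%R.
  have -> : mu [set x | shift T x \in A] = mu A.
    by rewrite !muE -[RHS](integral_shift T); apply: eq_integral => x; rewrite inE.
  by field.
rewrite /Y mu_join.
have : (mu N + mu O <= mu A + mu [set x | shift T x \in A])%R.
  rewrite !muE -!integralD; apply: integral_le => x; rewrite -!INR_addn; apply: INR_leq.
  rewrite /N /O !in_set.
  by case: (x \in W); case: (shift T x \in W); case: (x \in A); case: (shift T x \in A).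
have : (mu A + mu [set x | shift T x \in A] <= mu N + mu O + 2 * mu W2)%R.
  rewrite !muE -integralZ -!integralD; apply: integral_le => x.
  have -> : (2 * INR (x \in W2) = INR (2 * (x \in W2)))%R by rewrite INR_muln.
  rewrite -!INR_addn; apply: INR_leq; rewrite /N /O !in_set.
  by case: (x \in W); case: (shift T x \in W); case: (x \in A); case: (shift T x \in A).
lra.
Qed.

Lemma slice_double_out b : slice b (~: (Y :|: WY)) = if b then N' else O'.
Proof.
by apply/setP => x; rewrite in_slice in_setC in_setU !in_join; case: b; rewrite /N' /O' !in_set.
Qed.

Lemma deg_double_true x : x \in N -> deg (~: (Y :|: WY)) (cons true x) = deg N' x.
Proof.
move=> xN; rewrite deg_cons !slice_double_out /=.
suff -> : x \in O' = false by [].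
by move: xN; rewrite /O' !in_set => /and3P [/negbTE -> -> _].
Qed.

Lemma deg_double_false x :
  deg (~: (Y :|: WY)) (cons false x) = (x \in N') + deg O' x.
Proof. by rewrite deg_cons !slice_double_out. Qed.

(** Within the levels this is submodularity of the edge boundary, checked edge by edge in [D]. An
    edge between the levels leaves [Y] only above a point with exactly one of [x] and its translate
    in [A]; such points form [V] and its mirror image, counted in [E]. *)
Lemma edge_density_double :
  (edge_density Y (~: (Y :|: WY)) <= edge_density A B + mu V)%R.
Proof.
rewrite edge_densityE integral_cons.
suff : (integral (fun x => if cons true x \in Y then INR (deg (~: (Y :|: WY)) (cons true x)) else 0) +
  integral (fun x => if cons false x \in Y then INR (deg (~: (Y :|: WY)) (cons false x)) else 0) <=
  (edge_density A B + edge_density A B) + (mu V + mu V))%R by lra.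
have e2 : edge_density A B =
    integral (fun x => if shift T x \in A then INR (deg B (shift T x)) else 0%R).
  by rewrite edge_densityE -[LHS](integral_shift T).
have -> : (mu V + mu V = mu V + mu (escape B A T))%R by congr Rplus; exact: mu_escapeC.
rewrite {2}e2 edge_densityE !muE -!integralD.
apply: integral_le => x; rewrite !in_join /=.
have D : ((x \in N) * deg N' x + (x \in O) * deg O' x <=
   (x \in A) * deg B x + (shift T x \in A) * deg B (shift T x))%N.
  rewrite !degE !big_distrr -!big_split /=; apply: leq_sum => i _.
  rewrite flip_shift /N' /O' !in_set !inB.
  move: (@inW x) (@inW (shift T x)) (@inW (flip x i)) (@inW (shift T (flip x i))).
  case: (x \in W); case: (shift T x \in W); case: (flip x i \in W); case: (shift T (flip x i) \in W);
  case: (x \in A); case: (shift T x \in A); case: (flip x i \in A); case: (shift T (flip x i) \in A) => //=.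
have E : ((x \in O) * (x \in N') <= (x \in V) + (x \in escape B A T))%N.
  rewrite /N' !in_set !inB.
  move: (@inW x) (@inW (shift T x)).
  by case: (x \in W); case: (shift T x \in W); case: (x \in A); case: (shift T x \in A) => //=.
have C (b : bool) (m : nat) : (if b then INR m else 0%R) = INR (b * m)%N.
  by case: b; rewrite ?mul1n ?mul0n.
rewrite deg_double_false.
have -> : (if x \in N then INR (deg (~: (Y :|: WY)) (cons true x)) else 0%R) = INR ((x \in N) * deg N' x)%N.
  by rewrite -C; case: ifP => // xN; rewrite deg_double_true.
rewrite !C -!INR_addn; apply: INR_leq; rewrite mulnDr.
by rewrite addnCA addnC; exact: leq_add D E.
Qed.

(** A point of [N] lies on both levels. A neighbour in [V] is outside [N] but inside [O], so it
    makes the two outer degrees differ, and at least one of them must then deviate from [k]. *)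
Lemma edge_density_to_escape :
  (edge_density N V <= 2 * deviation k Y (~: (Y :|: WY)))%R.
Proof.
rewrite edge_densityE /deviation integral_cons.
have -> (a b : R) : (2 * ((a + b) / 2) = a + b)%R by field.
rewrite -integralD; apply: integral_le => x; rewrite !in_join /=.
have P0 : (0 <= if x \in O then Rabs (INR (deg (~: (Y :|: WY)) (cons false x)) - INR k) else 0)%R.
  by case: ifP => _; [exact: Rabs_pos | lra].
case: ifP => xN; last by rewrite Rplus_0_l.
rewrite deg_double_true //.
have -> : x \in O by move: xN; rewrite !in_set => /and3P [-> -> _].
rewrite deg_double_false (_ : x \in N' = false) ?add0n; last by rewrite /N' in_setC in_setU xN.
have D : (deg V x + deg O' x <= deg N' x)%N.
  rewrite !degE -!big_split /=; apply: leq_sum => i _.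
  rewrite /N' /O' /V /escape !in_set !inB.
  move: (@inW (flip x i)) (@inW (shift T (flip x i))).
  case: (flip x i \in W); case: (shift T (flip x i) \in W);
     case: (flip x i \in A); case: (shift T (flip x i) \in A) => //= /(_ isT) //.
have := INR_leq D; rewrite INR_addn.
have := Rle_abs (INR (deg N' x) - INR k).
have := Rabs_minus_sym (INR (deg O' x)) (INR k).
have := Rle_abs (INR k - INR (deg O' x)).
lra.
Qed.

(** An edge that leaves [V] and avoids [W2] ends in [B] or in [N], and a point of [A] has about [k]
    neighbours in [B]. *)
Lemma edge_density_escape :
  (edge_density V (~: (V :|: W2)) <= INR k * mu V + deviation k A B + edge_density N V)%R.
Proof.
have -> : edge_density N V = edge_density V N by rewrite /edge_density edge_bdC.
rewrite muE /deviation !edge_densityE -integralZ -!integralD; apply: integral_le => x.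
have [xV|xV] := ifP; last first.
  by case: ifP => _ /=; [have := Rabs_pos (INR (deg B x) - INR k) |]; lra.
have -> : x \in A by move: xV; rewrite inE => /andP [].
have D : (deg (~: (V :|: W2)) x <= deg B x + deg N x)%N.
  rewrite !degE -!big_split /=; apply: leq_sum => i _; rewrite !in_set !inB.
  by case: (flip x i \in W); case: (shift T (flip x i) \in W);
     case: (flip x i \in A); case: (shift T (flip x i) \in A) => //=.
have := INR_leq D; rewrite INR_addn /=; have := Rle_abs (INR (deg B x) - INR k); lra.
Qed.

Lemma disjoint_escape : [disjoint V & W2].
Proof.
apply: disjoint_setIP => x; rewrite !in_set => /andP [xA xB] /orP [xW|xW].
  by rewrite (inW xW) in xA.
by rewrite (disjointFl dBW xW) in xB.
Qed.

End Doubling.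

(** * Near-optimal partitions and the dichotomy for translates *)

Definition admissible k (f g : R -> R) : Prop :=
  [/\ (0 < k)%N,
   (forall x, (0 <= x <= 1)%R -> forall eps, (0 < eps)%R ->
     exists delta, (0 < delta)%R /\
       forall y, (0 <= y <= 1)%R -> (Rabs (y - x) < delta)%R ->
         (Rabs (g y - g x) < eps)%R),
   g (/ 2 ^ k)%R = (INR k / 2 ^ k)%R &
   (forall (n : nat) (A : {set cube n}), (1 <= n)%N ->
     (g (mu A) <= integral (fun x => f (INR (hS A x))))%R)] /\
  [/\ (forall x, (0 <= x)%R -> (0 <= f x)%R),
   (forall x y, (0 <= x)%R -> (x < y)%R -> (f x < f y)%R),
   strictly_concave f,
   f 0%R = 0%R &
   f (INR k) = INR k].

Definition near_optimal k (f : R -> R) n (eps : R) (A B W : {set cube n}) : Prop :=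
  [/\ (0 < n)%N, [disjoint A & B], [disjoint A & W], [disjoint B & W] &
      A :|: B :|: W = [set: cube n]] /\
  [/\ ((1 - eps) / 2 ^ k <= mu A <= (1 + eps) / 2 ^ k)%R,
      (mu W <= eps / f (INR n))%R &
      (edge_density A B <= (1 + eps) * INR k / 2 ^ k)%R].

(** Growth of [f] turns the bound on [mu W] into the one with [sqrt n] that expansion needs. The
    bound with [n.+1] is for the doubled set, which lives one dimension higher. *)
Lemma near_optimal_W k f g : admissible k f g -> exists c, (0 < c)%R /\
  forall n eps (A B W : {set cube n}), (0 < eps)%R -> near_optimal k f eps A B W ->
  [/\ (f (INR n) * mu W <= eps)%R, (f (INR n.+1) * mu W <= 2 * eps)%R,
      (mu W <= c * eps)%R & (sqrt (INR n) * mu W <= c * eps)%R].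
Proof.
move=> [[k0 gC gk iso] [f_ge0 f_inc fC f0 fk]].
have [c1 [c10 growth]] := sqrt_growth k0 gC gk f_ge0 f_inc f0 iso.
exists (/ c1)%R; split; first exact: Rinv_0_lt_compat.
move=> n eps A B W e0 [[n0 _ _ _ _] [_ muW _]].
have n1 : (1 <= INR n)%R by apply: (INR_leq n0).
have fn0 : (0 < f (INR n))%R by rewrite -f0; apply: f_inc; lra.
have W0 := mu_ge0 W.
have fW : (f (INR n) * mu W <= eps)%R.
  have -> : (eps = f (INR n) * (eps / f (INR n)))%R by field; lra.
  by apply: Rmult_le_compat_l => //; lra.
have sq1 : (1 <= sqrt (INR n))%R by apply: le_sqrt_sq; lra.
have sW : (sqrt (INR n) * mu W <= / c1 * eps)%R.
  have g1 := growth n n0.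
  apply: (Rmult_le_reg_l c1) => //.
  have -> : (c1 * (/ c1 * eps) = eps)%R by field; lra.
  nra.
split=> //; last by nra.
(* Concavity from 0 gives [f (n+1) <= 2 f ((n+1)/2) <= 2 f n]. *)
have := @concave_chord f 0 (INR n.+1) (/ 2) fC.
rewrite f0 S_INR => /(_ ltac:(lra) ltac:(lra) ltac:(lra) ltac:(lra)).
have : (f (0 + / 2 * (INR n + 1 - 0)) <= f (INR n))%R.
  case: (Rle_lt_or_eq_dec _ _ n1) => [lt|<-].
    by apply/Rlt_le/f_inc; lra.
  by have -> : (0 + / 2 * (1 + 1 - 0) = 1)%R; [field | lra].
nra.
Qed.

(* No translate moves an intermediate proportion of [A] into [B]: the doubled set [join N O] is again nearly
   optimal, so by rigidity few edges join the escaping part to the rest of [A], and small sets expand. *)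
Lemma escape_dichotomy k f g : admissible k f g -> exists eta, (0 < eta)%R /\
  forall d, (0 < d)%R -> exists e0, (0 < e0 <= 1)%R /\
  forall n eps (A B W : {set cube n}), (0 < eps <= e0)%R -> near_optimal k f eps A B W ->
  (deviation k A B <= d)%R /\
  forall T, (mu (escape A B T) <= d)%R \/ (eta <= mu (escape A B T))%R.
Proof.
move=> adm; have [c1 [c10 boundW]] := near_optimal_W adm.
have [[k0 gC gk iso] [f_ge0 f_inc fC f0 fk]] := adm.
have [s [c [s0 [c0 rigid]]]] := deviation_rigidity k0 gC gk f_inc fC f0 fk iso.
have kR : (1 <= INR k)%R by apply: (INR_leq k0).
have K := pow2_gt0 k.
have Ki : (0 < / 2 ^ k <= 1)%R.
  split; first exact/Rinv_0_lt_compat.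
  rewrite -Rinv_1; apply: Rinv_le_contravar; first lra.
  by apply: pow_R1_Rle; lra.
set q := (/ 2 ^ k)%R in rigid Ki.
(* The edges out of [V] cost [k] and rigidity of the doubled set costs [2 s / c] per unit of [mu V];
   the extra 1 leaves a bound on [mu V]. *)
pose L := (INR k + 2 * s / c + 1)%R.
have sc : (0 <= s / c)%R by apply: Rmult_le_pos => //; exact/Rlt_le/Rinv_0_lt_compat.
have L0 : (0 < L)%R by rewrite /L; lra.
have [eta [eta0 expand]] := small_set_expansion L0.
exists (eta / 2)%R; split; first lra.
move=> d d0.
(* Rigidity enters once for [A] and with weight two for the doubled set: the total [3 w] is half of
   [c * d]. *)
pose w := (d * c / 6)%R.
have w0 : (0 < w)%R by rewrite /w; nra.
have [rho [rho0 Hrho]] := rigid w w0.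
(* [M] collects the coefficients of [eps] in the error terms below. *)
pose M := ((2 * s * INR k + 1) / c + 2 * (2 * s * INR k * (1 + c1) + 4) / c + 2 * c1)%R.
have M0 : (0 < M)%R.
  have ci := Rinv_0_lt_compat c c0.
  have : (0 <= s * INR k)%R by nra.
  move=> sk; have : (0 <= s * INR k * c1)%R by nra.
  move=> skc; rewrite /M; apply: Rplus_lt_0_compat; last lra.
  by apply: Rplus_lt_0_compat; apply: Rmult_lt_0_compat => //; nra.
(* In order after 1: rigidity applies to [A] and to the doubled set, [W2] takes at most half of the
   expansion threshold, and the error terms stay below [d / 2]. *)
pose e0 := Rmin 1 (Rmin (rho / (1 + 2 * c1)) (Rmin (eta / (4 * c1)) (d / 2 / M))).
have e00 : (0 < e0)%R.
  by rewrite /e0; repeat apply: Rmin_pos; try lra; apply: Rdiv_lt_0_compat; lra.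
have [E1 [E2 [E3 E4]]] : (e0 <= 1 /\ e0 * (1 + 2 * c1) <= rho /\ 2 * c1 * e0 <= eta / 2 /\ e0 * M <= d / 2)%R.
  have m1 := Rmin_l 1 (Rmin (rho / (1 + 2 * c1)) (Rmin (eta / (4 * c1)) (d / 2 / M))).
  have m2 := Rmin_r 1 (Rmin (rho / (1 + 2 * c1)) (Rmin (eta / (4 * c1)) (d / 2 / M))).
  have m3 := Rmin_l (rho / (1 + 2 * c1)) (Rmin (eta / (4 * c1)) (d / 2 / M)).
  have m4 := Rmin_r (rho / (1 + 2 * c1)) (Rmin (eta / (4 * c1)) (d / 2 / M)).
  have m5 := Rmin_l (eta / (4 * c1)) (d / 2 / M).
  have m6 := Rmin_r (eta / (4 * c1)) (d / 2 / M).
  rewrite -/e0 in m1 m2.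
  split=> //; split; [|split].
  - have -> : (rho = rho / (1 + 2 * c1) * (1 + 2 * c1))%R by field; lra.
    by apply: Rmult_le_compat_r; lra.
  - have -> : (eta / 2 = 2 * c1 * (eta / (4 * c1)))%R by field; lra.
    by apply: Rmult_le_compat_l; lra.
  - have -> : (d / 2 = d / 2 / M * M)%R by field; lra.
    by apply: Rmult_le_compat_r; lra.
exists e0; split; first lra.
move=> n eps A B W [ep0 epe] near.
have [fW fW' Wc sW] := boundW n eps A B W ep0 near.
have [[n0 dAB dAW dBW ABW] [[muA1 muA2] _ edge]] := near.
have W0 := mu_ge0 W.
have eM : (eps * M <= d / 2)%R by nra.
have muA1' : (q - eps * q <= mu A)%R by move: muA1; rewrite /Rdiv -/q; lra.
have muA2' : (mu A <= q + eps * q)%R by move: muA2; rewrite /Rdiv -/q; lra.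
have ekq : (0 <= eps * INR k * (1 - q))%R by apply: Rmult_le_pos; nra.
have kA : (INR k * (q - eps * q) <= INR k * mu A)%R by apply: Rmult_le_compat_l; lra.
have edge' : (edge_density A B <= INR k * q + eps * INR k)%R.
  by move: edge; rewrite /Rdiv -/q; lra.
have devA : (c * deviation k A B <= w + eps * (2 * s * INR k + 1))%R.
  have := Hrho n A W n0 dAW.
  have -> : ~: (A :|: W) = B.
    apply/setP => x; have := in_setT x; rewrite -ABW !inE.
    have [xA|xA] /= := boolP (x \in A); first by rewrite (disjointFr dAB xA).
    by have [xB|xB] /= := boolP (x \in B); [rewrite (disjointFr dBW xB) | move=> ->].
  rewrite (mu_disjointU dAW) => H.
  have {}H := H _; have : (Rabs (mu A + mu W - q) <= rho)%R by apply: Rabs_le; nra.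
  move=> /H; have : (edge_density A B - INR k * mu A <= 2 * INR k * eps)%R by lra.
  move=> ed; have := Rmult_le_compat_l s _ _ s0 ed; lra.
have cd : (w + eps * (2 * s * INR k + 1) <= c * d)%R.
  have : (c * (eps * M) <= c * (d / 2))%R by apply: Rmult_le_compat_l; lra.
  have -> : (c * (eps * M) = eps * (2 * s * INR k + 1) + eps * 2 * (2 * s * INR k * (1 + c1) + 4) + 2 * eps * c1 * c)%R.
    by rewrite /M; field; lra.
  have : (0 <= eps * 2 * (2 * s * INR k * (1 + c1) + 4))%R.
    by apply: Rmult_le_pos; [lra | have : (0 <= s * INR k)%R by nra]; nra.
  have : (0 <= 2 * eps * c1 * c)%R by repeat apply: Rmult_le_pos; lra.
  rewrite /w; nra.
split; first by apply: (Rmult_le_reg_l c) => //; lra.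
move=> T; set V := escape A B T.
case: (Rle_lt_dec (eta / 2) (mu V)) => [|/Rlt_le] etaV; [by right | left].
pose W2 : {set cube n} := W :|: [set x | shift T x \in W].
have muW2 : (mu W2 <= 2 * mu W)%R := mu_W2 W T.
have W20 := mu_ge0 W2.
have dV := disjoint_escape T dAW dBW.
have small : (mu (V :|: W2) <= eta)%R.
  have := mu_setU V W2; nra.
have := expand n V W2 dV small.
have out := edge_density_escape k T dAB dBW ABW.
have toV := edge_density_to_escape k T dAB dAW dBW ABW.
have edY := edge_density_double T dAB dAW dBW ABW.
have [muY1 muY2] := mu_double A W T.
have dY := disjoint_double A W T.
rewrite -/V -/W2 in out toV edY muY1 muY2 dY.
set Y := join _ _ in toV edY muY1 muY2 dY.
set WY := join W2 W2 in toV edY dY.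
have muWY : mu WY = mu W2 by rewrite /WY mu_join; field.
have devY : (c * deviation k Y (~: (Y :|: WY)) <= s * mu V + w + eps * (2 * s * INR k * (1 + c1) + 4))%R.
  have := Hrho n.+1 Y WY isT dY.
  rewrite (mu_disjointU dY) muWY => H.
  have : (Rabs (mu Y + mu W2 - q) <= rho)%R by apply: Rabs_le; nra.
  move=> /H {}H; apply: Rle_trans H _.
  have fn0 : (0 <= f (INR n.+1))%R by apply: f_ge0; exact: pos_INR.
  have fW2 : (f (INR n.+1) * mu W2 <= 4 * eps)%R by nra.
  have kY : (INR k * (mu A - 2 * (c1 * eps)) <= INR k * mu Y)%R by apply: Rmult_le_compat_l; lra.
  have ed : (edge_density Y (~: (Y :|: WY)) - INR k * mu Y <= mu V + 2 * INR k * (1 + c1) * eps)%R by lra.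
  have := Rmult_le_compat_l s _ _ s0 ed; lra.
have V0 := mu_ge0 V.
have VV2 : (mu V <= mu (V :|: W2))%R by apply: mu_le; exact: subsetUl.
have sn0 := sqrt_pos (INR n).
have sW2 : (sqrt (INR n) * mu W2 <= 2 * c1 * eps)%R by nra.
move=> big; have : (L * mu V <= L * mu (V :|: W2))%R by apply: Rmult_le_compat_l; lra.
move=> big2.
have ineq : (L * mu V <= INR k * mu V + deviation k A B + 2 * deviation k Y (~: (Y :|: WY)) + 2 * c1 * eps)%R.
  lra.
have : (c * (L * mu V) <= c * (INR k * mu V) + (w + eps * (2 * s * INR k + 1)) +
   2 * (s * mu V + w + eps * (2 * s * INR k * (1 + c1) + 4)) + 2 * c1 * eps * c)%R.
  have := Rmult_le_compat_l c _ _ (Rlt_le _ _ c0) ineq; lra.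
have -> : (c * (L * mu V) = c * (INR k * mu V) + 2 * (s * mu V) + c * mu V)%R by rewrite /L; field; lra.
have eMc : (c * (eps * M) <= c * (d / 2))%R by apply: Rmult_le_compat_l; lra.
have E : (c * (eps * M) = eps * (2 * s * INR k + 1) + 2 * (eps * (2 * s * INR k * (1 + c1) + 4)) + 2 * c1 * eps * c)%R.
  by rewrite /M; field; lra.
move=> fin; apply: (Rmult_le_reg_l c) => //.
have : (3 * w = c * d / 2)%R by rewrite /w; field.
lra.
Qed.

(** * Translates avoiding the influential coordinates *)

Lemma shift_set0 n (x : cube n) : shift set0 x = x.
Proof. by apply/ffunP => j; rewrite ffunE inE addbF. Qed.

Lemma shift_set1 n i (x : cube n) : shift [set i] x = flip x i.
Proof. by apply/ffunP => j; rewrite ffunE flipE inE. Qed.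

Lemma shift_setD1 n (T : {set 'I_n}) i (x : cube n) :
  i \in T -> shift T x = flip (shift (T :\ i) x) i.
Proof.
move=> iT; apply/ffunP => j; rewrite flipE !ffunE !inE.
by have [->|] := eqVneq j i; rewrite ?iT ?addbF.
Qed.

Lemma mu0 n : mu (set0 : {set cube n}) = 0%R.
Proof. by rewrite /mu cards0 /Rdiv Rmult_0_l. Qed.

Lemma mu_preim_shift n (T : {set 'I_n}) (S : {set cube n}) : mu [set x | shift T x \in S] = mu S.
Proof. by rewrite !muE -[RHS](integral_shift T); apply: eq_integral => x; rewrite inE. Qed.

(** Induction on the size of [T]. If [x + T] is in [B], then [x + (T \ i)] is in [B], in [W], or in
    [A] with its [i]-flip in [B]. So one coordinate adds less than [mu W + eta], too little to jump
    from [d] to [2 * eta]. *)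
Lemma escape_chain n (A B W : {set cube n}) (J : {set 'I_n}) eta d :
  [disjoint A & B] -> A :|: B :|: W = setT -> (0 <= d)%R ->
  (forall T, mu (escape A B T) <= d \/ 2 * eta <= mu (escape A B T))%R ->
  (forall i, i \notin J -> mu (escape A B [set i]) < eta)%R ->
  (d + mu W <= eta)%R ->
  forall T : {set 'I_n}, [disjoint T & J] -> (mu (escape A B T) <= d)%R.
Proof.
move=> dAB ABW d0 dich infl small T.
have [m] := ubnP #|T|; elim: m T => // m IHm T; rewrite ltnS => Tm dTJ.
have [->|[i iT]] := set_0Vmem T.
  rewrite (_ : escape A B set0 = set0) ?mu0 //; apply/setP => x.
  by rewrite !inE shift_set0; apply/negP => /andP [xA]; rewrite (disjointFr dAB xA).
have := IHm (T :\ i) _ _; rewrite (cardsD1 i T) iT in Tm.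
move=> /(_ Tm (disjointWl (subD1set _ _) dTJ)) IH.
have iJ : i \notin J by rewrite (disjointFr dTJ iT).
have cover : escape A B T \subset escape A B (T :\ i) :|:
    ([set x | shift (T :\ i) x \in W] :|: [set x | shift (T :\ i) x \in escape A B [set i]]).
  apply/subsetP => x; rewrite !inE shift_set1 => /andP [-> sB] /=.
  rewrite -(shift_setD1 _ iT) sB andbT.
  by have := in_setT (shift (T :\ i) x); rewrite -ABW !inE orbC orbA orbC => ->; rewrite ?orbT.
have le3 (X Y Z : {set cube n}) : (mu (X :|: (Y :|: Z)) <= mu X + (mu Y + mu Z))%R.
  by apply: Rle_trans (mu_setU _ _) _; apply: Rplus_le_compat_l; exact: mu_setU.
have := Rle_trans _ _ _ (mu_le cover) (le3 _ _ _); rewrite !mu_preim_shift => up.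
have lti := infl i iJ; case: (dich T) => // lo; exfalso.
move: up lo IH lti; set a := mu _; set b := mu _; set c := mu (escape A B [set i]); lra.
Qed.

Lemma edge_density_sum_dir n (A B : {set cube n}) :
  edge_density A B = \big[Rplus/0%R]_(i < n) mu (escape A B [set i]).
Proof.
rewrite /mu /Rdiv -big_distrl /= /edge_density edge_bdE; congr Rmult.
rewrite -INR_sum; congr INR.
have -> : \sum_(x in A) deg B x = \sum_(x in A) \sum_(i < n) (flip x i \in B).
  by apply: eq_bigr => x _; rewrite degE.
rewrite exchange_big /=; apply: eq_bigr => i _.
rewrite -sum1_card -big_mkcondr /=; apply: eq_bigl => x.
by rewrite inE shift_set1.
Qed.

(** Markov's inequality: the influences of all directions add up to the edge density. *)
Lemma card_influential n (A B : {set cube n}) eta : (0 < eta)%R ->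
  (INR #|[set i | Rle_dec eta (mu (escape A B [set i]))]| * eta <= edge_density A B)%R.
Proof.
move=> eta0; rewrite edge_density_sum_dir INR_card big_distrl /=.
apply: rsum_le => i _; rewrite inE; case: Rle_dec => /= H; first by rewrite Rmult_1_l.
by rewrite Rmult_0_l; exact: mu_ge0.
Qed.

Lemma exists_set_card n k : k <= n -> exists I : {set 'I_n}, #|I| = k.
Proof.
move=> kn; exists [set widen_ord kn i | i in 'I_k].
rewrite card_imset ?card_ord // => i j /(congr1 val) /= ij; exact: val_inj.
Qed.

(** * Approximation by a subcube *)

Section Fibers.
Variables (n : nat) (J : {set 'I_n}).
Implicit Types (x y z : cube n) (S A B : {set cube n}).

Definition fiber x : {set cube n} := [set y : cube n | [forall j in J, y j == x j]].

Lemma fiberP x y : reflect (forall j, j \in J -> y j = x j) (y \in fiber x).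
Proof. by rewrite inE; apply: (iffP forall_inP) => H j /H /eqP. Qed.

Lemma fiber_refl x : x \in fiber x.
Proof. exact/fiberP. Qed.

Lemma fiber_eq x y : y \in fiber x -> fiber y = fiber x.
Proof.
move/fiberP => E; apply/setP => z.
by apply/fiberP/fiberP => H j jJ; rewrite H // E.
Qed.

Lemma fiber_sym x y : (y \in fiber x) = (x \in fiber y).
Proof. by apply/fiberP/fiberP => H j jJ; rewrite H. Qed.

Lemma shift_inj x : injective (fun T : {set 'I_n} => shift T x).
Proof.
move=> T T' /ffunP E; apply/setP => j; have := E j; rewrite !ffunE; exact: addbI.
Qed.

Lemma fiberE x : fiber x = [set shift T x | T in powerset (~: J)].
Proof.
apply/setP => y; apply/fiberP/imsetP => [E|[T + -> j jJ]].
  exists [set j | x j (+) y j].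
    rewrite powersetE; apply/subsetP => j; rewrite !inE.
    by apply: contraTN => /E ->; rewrite addbb.
  by apply/ffunP => j; rewrite ffunE inE addbA addbb.
rewrite powersetE => /subsetP /(_ j); rewrite ffunE inE jJ.
by case: (j \in T) => [/(_ isT)|]; rewrite ?addbF.
Qed.

Lemma card_fiber x : #|fiber x| = 2 ^ #|~: J|.
Proof. by rewrite fiberE card_imset ?card_powerset //; exact: shift_inj. Qed.

Lemma cube_fiber : 2 ^ n = 2 ^ #|~: J| * 2 ^ #|J|.
Proof. by rewrite -expnD addnC cardsC card_ord. Qed.

Lemma flip_fiber x y j : y \in fiber x -> flip y j \in fiber (flip x j).
Proof. by move=> /fiberP E; apply/fiberP => i iJ; rewrite !flipE E. Qed.

Lemma flip_fiber_out x j : j \notin J -> flip x j \in fiber x.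
Proof.
move=> jJ; apply/fiberP => i iJ; rewrite flipE.
by have [ij|] := eqVneq i j; [rewrite -ij iJ in jJ | rewrite addbF].
Qed.

Lemma sum_fiber S : \sum_z #|S :&: fiber z| = 2 ^ #|~: J| * #|S|.
Proof.
have -> : \sum_z #|S :&: fiber z| = \sum_z \sum_(x in S) (z \in fiber x).
  apply: eq_bigr => z _; rewrite -sum1_card -big_mkcondr /=.
  by apply: eq_bigl => x; rewrite inE fiber_sym.
rewrite exchange_big /= -[#|S|]sum1_card big_distrr /=; apply: eq_bigr => x _.
by rewrite muln1 -(card_fiber x) -sum1_card [RHS]big_mkcond; apply: eq_bigr => z _; case: ifP.
Qed.

Lemma sum_escape A B :
  \sum_(T in powerset (~: J)) #|escape A B T| = \sum_(x in A) #|B :&: fiber x|.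
Proof.
have -> : \sum_(T in powerset (~: J)) #|escape A B T| =
    \sum_(T in powerset (~: J)) \sum_(x in A) (shift T x \in B).
  apply: eq_bigr => T _; rewrite -sum1_card -big_mkcondr /=.
  by apply: eq_bigl => x; rewrite inE.
rewrite exchange_big /=; apply: eq_bigr => x _.
have -> : B :&: fiber x = [set shift T x | T in [set T in powerset (~: J) | shift T x \in B]].
  rewrite fiberE; apply/setP => y; rewrite inE; apply/andP/imsetP.
    by move=> [yB /imsetP [T TJ E]]; exists T; rewrite // inE TJ -E.
  by move=> [T]; rewrite inE => /andP [TJ sB] ->; split=> //; apply: imset_f.
rewrite card_imset; last exact: shift_inj.
rewrite -sum1_card -big_mkcondr /=; apply: eq_bigl => T; by rewrite [in RHS]inE.
Qed.

(** Two points of one fiber differ by a unique translation avoiding [J], so every pair is counted by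
    one [T]. *)
Lemma fiber_product A B z :
  #|A :&: fiber z| * #|B :&: fiber z| <= \sum_(T in powerset (~: J)) #|escape A B T|.
Proof.
rewrite sum_escape -sum1_card big_distrl /=.
rewrite [X in _ <= X](bigID (mem (fiber z))) /=.
apply: leq_trans (leq_addr _ _).
rewrite (eq_bigl (fun x => (x \in A) && (x \in fiber z))); last by move=> x; rewrite inE.
by apply: leq_sum => x /andP [_ xz]; rewrite mul1n (fiber_eq xz).
Qed.

(** [D] is a union of fibers of equal size. This integrality later upgrades approximate measure to
    exact measure. *)
Lemma card_saturated (D : {set cube n}) :
  (forall x y, y \in fiber x -> (y \in D) = (x \in D)) ->
  exists t, #|D| = t * 2 ^ #|~: J|.
Proof.
move=> sat; pose r := [rel x y | y \in fiber x].
have eqr : {in D & &, equivalence_rel r}.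
  by move=> x y z _ _ _; split; [exact: fiber_refl | move=> /= /fiber_eq ->].
have part := equivalence_partitionP eqr.
exists #|equivalence_partition r D|; apply: card_uniform_partition part.
move=> P /imsetP [x xD ->]; rewrite -(card_fiber x); apply: eq_card => y.
rewrite inE /=; case yx : (y \in fiber x); rewrite ?andbF //.
by rewrite (sat _ _ yx) xD.
Qed.

End Fibers.

Lemma card_le_mu n (S : {set cube n}) d : (mu S <= d)%R -> (INR #|S| <= d * 2 ^ n)%R.
Proof.
have N := pow2_gt0 n; rewrite /mu => H.
have -> : (INR #|S| = INR #|S| / 2 ^ n * 2 ^ n)%R by field; lra.
by apply: Rmult_le_compat_r => //; lra.
Qed.

(** Degrees are integers, so one different from [k] deviates by at least 1. *)
Lemma mu_deviation n k (A B : {set cube n}) :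
  (mu [set x in A | deg B x != k] <= deviation k A B)%R.
Proof.
rewrite muE /deviation; apply: integral_le => x; rewrite inE.
case: (x \in A) => /=; last exact: Rle_refl.
case: eqP => [_|/eqP ne] /=; first exact: Rabs_pos.
have [lt|lt] : (deg B x < k \/ k < deg B x)%N by lia.
  have := INR_leq lt; rewrite S_INR => h; rewrite Rabs_left; lra.
have := INR_leq lt; rewrite S_INR => h; rewrite Rabs_right; lra.
Qed.

(* [D] is the majority vote of [A] on the fibers over [J]; averaging the escape bound over all translates fixing
   [J] shows that [A] fills or avoids almost all of each fiber. *)
Lemma junta_subcube n k (A B W : {set cube n}) (J : {set 'I_n}) (d : R) :
  [disjoint A & B] -> [disjoint A & W] -> [disjoint B & W] -> A :|: B :|: W = setT ->
  k <= #|J| ->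
  (forall T : {set 'I_n}, [disjoint T & J] -> (mu (escape A B T) <= d)%R) ->
  (deviation k A B <= d)%R ->
  (Rabs (mu A - / 2 ^ k) <= d)%R -> (mu W <= d)%R ->
  (10 * (INR #|J| + 1) * (2 ^ #|J| * 2 ^ #|J|) * d < 1)%R ->
  exists C, subcube k C /\ (mu (symdiff C A) <= 5 * 2 ^ #|J| * d)%R.
Proof.
move=> dAB dAW dBW ABW kJ esc dev muA muW small.
set m := #|J| in kJ small *; pose M := 2 ^ #|~: J|.
have M0 : (0 < INR M)%R by rewrite /M INR_expn; exact: pow2_gt0.
have J0 : (1 <= 2 ^ m)%R by apply: pow_R1_Rle; lra.
have d0 : (0 <= d)%R by have := mu_ge0 W; lra.
have m0 := pos_INR m.
have NE : (2 ^ n = INR M * 2 ^ m)%R.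
  by rewrite -!INR_expn -INR_muln; congr INR; exact: cube_fiber.
(* [th] is [d] rescaled to a single fiber: a set of measure [d] has [th * M] points. *)
pose th := (d * 2 ^ m)%R.
have th0 : (0 <= th)%R by rewrite /th; nra.
have thsmall : (10 * (INR m + 1) * (th * 2 ^ m) < 1)%R by rewrite /th; lra.
have th1 : (10 * (INR m + 1) * th < 1)%R.
  have : (0 <= 10 * (INR m + 1) * th * (2 ^ m - 1))%R by repeat apply: Rmult_le_pos; lra.
  lra.
have thd : (d <= th)%R by rewrite /th; nra.
have dN : (d * 2 ^ n = th * INR M)%R by rewrite NE /th; ring.
pose a z : R := INR #|A :&: fiber J z|; pose b z : R := INR #|B :&: fiber J z|.
pose w z : R := INR #|W :&: fiber J z|.
have abw z : (a z + b z + w z = INR M)%R.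
  rewrite /a /b /w -!INR_addn; congr INR; rewrite -[RHS](card_fiber J z).
  rewrite !card_indicator -!big_split /=; apply: eq_bigr => x _.
  rewrite !in_setI; case: (x \in fiber J z); rewrite ?andbF // !andbT.
  have := in_setT x; rewrite -ABW !in_setU.
  have [xA|xA] /= := boolP (x \in A); first by rewrite (disjointFr dAB xA) (disjointFr dAW xA).
  by have [xB|xB] /= := boolP (x \in B); [rewrite (disjointFr dBW xB) | move=> ->].
have wle z : (w z <= th * INR M)%R.
  rewrite -dN; apply: Rle_trans (card_le_mu muW); apply: INR_leq.
  by apply: subset_leq_card; exact: subsetIl.
have a0 z : (0 <= a z)%R by exact: pos_INR.
have b0 z : (0 <= b z)%R by exact: pos_INR.
have w0 z : (0 <= w z)%R by exact: pos_INR.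
have ab z : (a z * b z <= th * (INR M * INR M))%R.
  rewrite /a /b -INR_muln; apply: Rle_trans (INR_leq (fiber_product J A B z)) _.
  rewrite INR_sum; apply: Rle_trans (_ : \rsum_(T in powerset (~: J)) (th * INR M) <= _)%R.
    apply: rsum_le => T; rewrite powersetE => TJ; rewrite -dN; apply: card_le_mu; apply: esc.
    by rewrite disjoints_subset.
  have -> : (\rsum_(T in powerset (~: J)) (th * INR M) = INR #|powerset (~: J)| * (th * INR M))%R.
    rewrite big_const; elim: #|_| => [|i IHi]; first by rewrite /= Rmult_0_l.
    by rewrite S_INR /= IHi; ring.
  rewrite card_powerset -/M; lra.
pose D : {set cube n} := [set z | M <= 2 * #|A :&: fiber J z|].
have inD z : z \in D -> (INR M - a z <= 5 * th * INR M)%R.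
  rewrite inE => /INR_leq; rewrite INR_muln -/(a z) /= => Ma.
  have bz : (b z <= 2 * th * INR M)%R.
    apply: (Rmult_le_reg_l (INR M)) => //; have := ab z; have := b0 z; nra.
  have := abw z; have := wle z; nra.
have outD z : z \notin D -> (INR M - b z <= 5 * th * INR M)%R.
  rewrite inE -ltnNge => /ltnW /INR_leq; rewrite INR_muln -/(a z) /= => Ma.
  have bz : (INR M <= 4 * b z)%R by have := abw z; have := wle z; nra.
  have az : (a z <= 4 * th * INR M)%R.
    apply: (Rmult_le_reg_l (INR M)) => //; have := ab z; have := a0 z; nra.
  have := abw z; have := wle z; nra.
have Dsat x y : y \in fiber J x -> (y \in D) = (x \in D).
  by move=> yx; rewrite !inE (fiber_eq yx).
have muDA : (mu (symdiff D A) <= 5 * th)%R.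
  have fib z : (INR #|symdiff D A :&: fiber J z| <= 5 * th * INR M)%R.
    have [zD|zD] := boolP (z \in D).
      have := inD z zD; suff -> : INR #|symdiff D A :&: fiber J z| = (INR M - a z)%R by [].
      suff E : #|fiber J z| = #|A :&: fiber J z| + #|symdiff D A :&: fiber J z|.
        by rewrite /M -(card_fiber J z) E INR_addn /a; ring.
      rewrite -(cardsID A) setIC; congr (_ + _); apply: eq_card => x.
      rewrite in_setD in_setI in_setU !in_setD; have [xz|] := boolP (x \in fiber J z); last by rewrite !andbF.
      by rewrite (Dsat _ _ xz) zD; case: (x \in A).
    have az : (a z <= INR M - b z)%R by have := abw z; have := w0 z; lra.
    apply: Rle_trans (Rle_trans _ _ _ az (outD z zD)); apply: INR_leq.
    apply: subset_leq_card; apply/subsetP => x; rewrite in_setI [in X in _ -> X]in_setI => /andP [+ xz].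
    have := Dsat _ _ xz; rewrite (negbTE zD) in_setU !in_setD => -> /=.
    by rewrite xz andbT andbF.
  have : (INR M * INR #|symdiff D A| <= INR M * (5 * th * 2 ^ n))%R.
    rewrite -INR_muln -(sum_fiber J) INR_sum.
    apply: Rle_trans (_ : \big[Rplus/0]_(z : cube n) (5 * th * INR M) <= _)%R; first exact: rsum_le.
    rewrite big_const card_cube -INR_expn.
    apply: Req_le; elim: (2 ^ n)%N => [|i IHi]; first by rewrite /=; ring.
    by rewrite S_INR /= IHi; ring.
  move/(Rmult_le_reg_l _ _ _ M0) => H.
  have N := pow2_gt0 n; apply: (Rmult_le_reg_r (2 ^ n)) => //.
  by have -> : (mu (symdiff D A) * 2 ^ n = INR #|symdiff D A|)%R by rewrite /mu; field; lra.
have [t cD] := card_saturated Dsat; rewrite -/M in cD.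
have muD : (Rabs (mu D - mu A) <= 5 * th)%R.
  have : (mu D <= mu A + mu (symdiff D A))%R.
    apply: Rle_trans (mu_setU _ _); apply: mu_le; apply/subsetP => x; rewrite !in_setU !in_setD.
    by case: (x \in D); case: (x \in A).
  have : (mu A <= mu D + mu (symdiff D A))%R.
    apply: Rle_trans (mu_setU _ _); apply: mu_le; apply/subsetP => x; rewrite !in_setU !in_setD.
    by case: (x \in D); case: (x \in A).
  by move=> *; apply: Rabs_le; lra.
(* Both [mu D] and [2^-k] are multiples of [2^-m], and they differ by less than one such unit. *)
have tE : t = 2 ^ (m - k).
  have E : (mu D = INR t / 2 ^ m)%R.
    by rewrite /mu cD INR_muln NE; field; lra.
  have K := pow2_gt0 k.
  have E2 : (/ 2 ^ k = INR (2 ^ (m - k)) / 2 ^ m)%R.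
    have -> : (2 ^ m = 2 ^ (m - k) * 2 ^ k)%R by rewrite -!INR_expn -INR_muln -expnD subnK.
    by rewrite INR_expn; have := pow2_gt0 (m - k) => ?; field; lra.
  have close : (Rabs (mu D - / 2 ^ k) <= 6 * th)%R.
    have -> : (mu D - / 2 ^ k = (mu D - mu A) + (mu A - / 2 ^ k))%R by ring.
    apply: Rle_trans (Rabs_triang _ _) _; lra.
  have : (Rabs (INR t - INR (2 ^ (m - k))) < 1)%R.
    have -> : (INR t - INR (2 ^ (m - k)) = (mu D - / 2 ^ k) * 2 ^ m)%R.
      by rewrite E E2; field; lra.
    rewrite Rabs_mult (Rabs_pos_eq (2 ^ m)); last lra.
    have : (0 <= th * 2 ^ m)%R by nra.
    move=> tm; have : (th * 2 ^ m * (10 * INR m) >= 0)%R by nra.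
    nra.
  move/Rabs_def2 => [h1 h2].
  have [lt|[//|lt]] : (t < 2 ^ (m - k) \/ t = 2 ^ (m - k) \/ 2 ^ (m - k) < t)%N by lia.
    by have := INR_leq lt; rewrite S_INR; lra.
  by have := INR_leq lt; rewrite S_INR; lra.
have cDk : #|D| * 2 ^ k = 2 ^ n.
  by rewrite cD tE mulnAC -expnD subnK // mulnC (cube_fiber J).
have degD x : x \in D -> deg (~: D) x <= k.
  move=> xD.
  (* A point [y] of the fiber outside [bad] is in [A], has exactly [k] neighbours in [B], and every
     direction of [J] leading out of [D] takes it into [B]. Directions outside [J] stay in the
     fiber. Hence the outer degree of [x] is at most [k]. *)
  pose bad := (~: A :&: fiber J x) :|: [set y in A | deg B y != k] :|:
     \bigcup_(j in J | flip x j \notin D) [set y in fiber J x | flip y j \notin B].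
  have badle : (INR #|bad| < INR M)%R.
    have c1 : (INR #|~: A :&: fiber J x| <= 5 * th * INR M)%R.
      apply: Rle_trans (inD x xD).
      have -> : ~: A :&: fiber J x = fiber J x :\: A by rewrite setDE setIC.
      by rewrite /a /M -(card_fiber J x) -(cardsID A (fiber J x)) INR_addn [A :&: _]setIC; lra.
    have c2 : (INR #|[set y in A | deg B y != k]| <= th * INR M)%R.
      by rewrite -dN; apply: card_le_mu; apply: Rle_trans (mu_deviation _ _ _) dev.
    have c3 : (INR #|\bigcup_(j in J | flip x j \notin D) [set y in fiber J x | flip y j \notin B]| <=
       INR m * (5 * th * INR M))%R.
      apply: Rle_trans (_ : INR (\sum_(j in J | flip x j \notin D) #|[set y in fiber J x | flip y j \notin B]|) <= _)%R.
        apply: INR_leq; elim/big_rec2: _ => [|j u S _ IH]; first by rewrite cards0.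
        apply: leq_trans (_ : #|[set y in fiber J x | flip y j \notin B]| + #|S| <= _).
          by rewrite cardsU leq_subr.
        by rewrite leq_add2l.
      rewrite INR_sum /m INR_card big_distrl /= big_mkcond /=; apply: rsum_le => j _.
      case: (j \in J) => /=; last by rewrite Rmult_0_l; exact: Rle_refl.
      case: ifP => fD; last by rewrite Rmult_1_l; repeat apply: Rmult_le_pos; lra.
      rewrite Rmult_1_l; apply: Rle_trans (outD _ fD).
      have -> : #|[set y in fiber J x | flip y j \notin B]| = #|fiber J (flip x j) :\: B|.
        rewrite -(card_imset _ (inv_inj (@flipK n j))); apply: eq_card => y.
        rewrite inE; apply/imsetP/andP => [[u]|[yB yx]].
          by rewrite inE => /andP [ux uB] ->; rewrite uB flip_fiber.
        exists (flip y j); last by rewrite flipK.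
        by rewrite inE flipK yB andbT -[x](flipK j) flip_fiber.
      rewrite /M -(card_fiber J (flip x j)) -(cardsID B (fiber J (flip x j))) INR_addn /b.
      by rewrite [B :&: _]setIC; lra.
    have U1 : #|bad| <= #|~: A :&: fiber J x| + #|[set y in A | deg B y != k]| +
      #|\bigcup_(j in J | flip x j \notin D) [set y in fiber J x | flip y j \notin B]|.
      by rewrite /bad cardsU; apply: leq_trans (leq_subr _ _) _; rewrite leq_add2r cardsU leq_subr.
    have := INR_leq U1; rewrite !INR_addn => U2.
    have : ((10 * (INR m + 1) * th) * INR M < 1 * INR M)%R by apply: Rmult_lt_compat_r.
    have : (0 <= th * INR M * (4 + 5 * INR m))%R by repeat apply: Rmult_le_pos; lra.
    nra.
  have [y yx ybad] : exists2 y, y \in fiber J x & y \notin bad.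
    apply/subsetPn; apply/negP => /subset_leq_card /INR_leq.
    by rewrite card_fiber -/M; lra.
  move: ybad; rewrite !in_setU !negb_or => /andP [/andP [yA yk] yB].
  have {}yA : y \in A by move: yA; rewrite !inE; move: yx; rewrite inE => ->; rewrite andbT negbK.
  have {yk}<- : deg B y = k by move: yk; rewrite inE yA /= negbK => /eqP.
  rewrite !degE; apply: leq_sum => j _.
  rewrite inE; case fD : (flip x j \in D) => //=.
  have jJ : j \in J.
    by apply: contraFT fD => jJ; rewrite (Dsat x) //; exact: flip_fiber_out.
  suff -> : flip y j \in B by [].
  apply: contraR yB => fB; apply/bigcupP; exists j; first by rewrite jJ fD.
  by rewrite inE yx fB.
have D0 : D != set0.
  by apply/eqP => D00; move: cDk; rewrite D00 cards0 mul0n => /esym/eqP; rewrite expn_eq0.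
have [_ sub] := outdeg_subcube degD D0.
exists D; split; first by apply: sub; rewrite cDk.
by rewrite /th in muDA; lra.
Qed.

Lemma pow2_le m m' : m <= m' -> (2 ^ m <= 2 ^ m')%R.
Proof. by move=> le; rewrite -!INR_expn; apply: INR_leq; rewrite leq_pexp2l. Qed.

Lemma Rinv_pow2 k : (0 < / 2 ^ k <= 1)%R.
Proof.
split; first exact/Rinv_0_lt_compat/pow2_gt0.
by rewrite -Rinv_1; apply: Rinv_le_contravar; [lra | apply: pow_R1_Rle; lra].
Qed.

(** The order of choices keeps everything uniform in [n]: [eta] bounds the size of [J] by [m0], then
    [m0] determines [d1], and [d1] determines [e0]. *)
Lemma near_subcube k f g : admissible k f g -> forall d, (0 < d)%R ->
  exists e0, (0 < e0)%R /\
  forall n eps (A B W : {set cube n}), k <= n -> (0 < eps <= e0)%R ->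
    near_optimal k f eps A B W ->
  exists C, subcube k C /\ (mu (symdiff C A) <= d)%R.
Proof.
move=> adm d d0; have [c1 [c10 boundW]] := near_optimal_W adm.
have [eta [eta0 dich]] := escape_dichotomy adm.
have k0 : 0 < k by case: adm => -[].
have kR : (1 <= INR k)%R by apply: (INR_leq k0).
(* The edge density is at most [2 k], so at most [4 k / eta] coordinates have influence [eta / 2] or
   more; [k] further ones are added below. *)
have [m0 Hm0] := INR_unbounded (4 * INR k / eta + INR k)%R.
have P0 := pow2_gt0 m0; have m00 := pos_INR m0.
pose Q := (20 * (INR m0 + 1) * (2 ^ m0 * 2 ^ m0))%R.
have Q0 : (0 < Q)%R by rewrite /Q; repeat apply: Rmult_lt_0_compat; lra.
pose d1 := Rmin (eta / 4) (Rmin (/ Q) (d / (5 * 2 ^ m0))).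
have d10 : (0 < d1)%R.
  rewrite /d1; repeat apply: Rmin_pos; [lra | exact: Rinv_0_lt_compat |].
  by apply: Rdiv_lt_0_compat; lra.
have [D1 [D2 D3]] : (d1 <= eta / 4 /\ Q * d1 <= 1 /\ 5 * 2 ^ m0 * d1 <= d)%R.
  have h1 := Rmin_l (eta / 4) (Rmin (/ Q) (d / (5 * 2 ^ m0))).
  have h2 := Rmin_r (eta / 4) (Rmin (/ Q) (d / (5 * 2 ^ m0))).
  have h3 := Rmin_l (/ Q) (d / (5 * 2 ^ m0)).
  have h4 := Rmin_r (/ Q) (d / (5 * 2 ^ m0)).
  rewrite -/d1 in h1 h2; split; [lra | split].
    rewrite -(Rinv_r Q); last lra.
    by apply: Rmult_le_compat_l; lra.
  have -> : (d = 5 * 2 ^ m0 * (d / (5 * 2 ^ m0)))%R by field; lra.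
  by apply: Rmult_le_compat_l; lra.
have [e1 [[e10 e11] He1]] := dich d1 d10.
pose e0 := Rmin e1 (Rmin (d1 / c1) d1).
have d1c : (0 < d1 / c1)%R by apply: Rdiv_lt_0_compat.
have e00 : (0 < e0)%R by apply: Rmin_pos => //; apply: Rmin_pos.
have [E1 [E2 E3]] : (e0 <= e1 /\ c1 * e0 <= d1 /\ e0 <= d1)%R.
  have h1 := Rmin_l e1 (Rmin (d1 / c1) d1); have h2 := Rmin_r e1 (Rmin (d1 / c1) d1).
  have h3 := Rmin_l (d1 / c1) d1; have h4 := Rmin_r (d1 / c1) d1.
  rewrite -/e0 in h1 h2; split; [lra | split; last lra].
  have -> : (d1 = c1 * (d1 / c1))%R by field; lra.
  by apply: Rmult_le_compat_l; lra.
exists e0; split=> // n eps A B W kn [ep0 epe] near.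
have [dev esc] := He1 n eps A B W ltac:(lra) near.
have [_ _ Wc _] := boundW n eps A B W ep0 near.
have Wd : (mu W <= d1)%R by nra.
have [[n0 dAB dAW dBW ABW] [[muA1 muA2] _ edge]] := near.
have [Ki0 Ki1] := Rinv_pow2 k.
pose J0 := [set i | Rle_dec (eta / 2) (mu (escape A B [set i]))].
(* These [k] arbitrary coordinates only ensure that [J] has at least [k] elements, so that [2^-k] is
   a multiple of [2^-|J|]. *)
have [I0 cI0] := exists_set_card kn.
pose J := J0 :|: I0.
have Jm0 : #|J| <= m0.
  have := @card_influential n A B (eta / 2) ltac:(lra); rewrite -/J0 => cJ0.
  have ed2 : (edge_density A B <= 2 * INR k)%R.
    apply: Rle_trans edge _; rewrite /Rdiv.
    have : (0 <= (1 + eps) * INR k * (1 - / 2 ^ k))%R by repeat apply: Rmult_le_pos; lra.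
    nra.
  have J0k : (INR #|J0| <= 4 * INR k / eta)%R.
    apply: (Rmult_le_reg_r (eta / 2)); first lra.
    have -> : (4 * INR k / eta * (eta / 2) = 2 * INR k)%R by field; lra.
    lra.
  apply: leq_trans (_ : #|J0| + k <= _); first by rewrite /J -cI0 cardsU leq_subr.
  apply/leP/INR_le; rewrite plus_INR; lra.
have kJ : k <= #|J| by rewrite -cI0; apply: subset_leq_card; exact: subsetUr.
have escJ : forall T : {set 'I_n}, [disjoint T & J] -> (mu (escape A B T) <= d1)%R.
  apply: (escape_chain (eta := eta / 2) dAB ABW); [lra | | | lra].
    move=> T; have -> : (2 * (eta / 2) = eta)%R by field.
    exact: esc.
  move=> i; rewrite /J in_setU negb_or => /andP [+ _].
  by rewrite inE; case: Rle_dec => //= H _; lra.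
have pm := pow2_le Jm0; have P1 := pow2_gt0 #|J|.
have mm := INR_leq Jm0; have m1 := pos_INR #|J|.
have muA : (Rabs (mu A - / 2 ^ k) <= d1)%R.
  rewrite /Rdiv in muA1 muA2.
  have : (0 <= eps * (1 - / 2 ^ k))%R by apply: Rmult_le_pos; lra.
  by move=> h; apply: Rabs_le; lra.
have pp : (2 ^ #|J| * 2 ^ #|J| <= 2 ^ m0 * 2 ^ m0)%R by apply: Rmult_le_compat; lra.
have small : (10 * (INR #|J| + 1) * (2 ^ #|J| * 2 ^ #|J|) * d1 < 1)%R.
  have : (10 * (INR #|J| + 1) * (2 ^ #|J| * 2 ^ #|J|) <= 10 * (INR m0 + 1) * (2 ^ m0 * 2 ^ m0))%R.
    by apply: Rmult_le_compat; try lra; apply: Rmult_le_pos; lra.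
  move/(Rmult_le_compat_r d1 _ _ (Rlt_le _ _ d10)).
  by rewrite /Q in D2; lra.
have [C [sC muC]] := junta_subcube dAB dAW dBW ABW kJ escJ dev muA Wd small.
exists C; split=> //; apply: Rle_trans muC _; apply: Rle_trans D3.
by apply: Rmult_le_compat_r; lra.
Qed.

(** * The linear bound *)

Definition std_subcube n (I : {set 'I_n}) (z : cube n) : {set cube n} :=
  [set x : cube n | [forall i in I, x i == z i]].

(** A point outside violates some fixed coordinate, and only flipping that one can bring it in. *)
Lemma deg_std_subcube n (I : {set 'I_n}) z x :
  x \notin std_subcube I z -> deg (std_subcube I z) x <= 1.
Proof.
rewrite inE => /forall_inPn [i iI xi]; rewrite degE (bigD1 i) //= big1 => [|j ji].
  by rewrite addn0; case: (_ \in _).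
rewrite inE; apply/eqP; rewrite eqb0; apply/forall_inPn; exists i => //.
by rewrite flipE [i == j]eq_sym (negbTE ji) addbF.
Qed.

Lemma edge_density_le n (S T : {set cube n}) c :
  (forall x, x \in S -> (INR (deg T x) <= c)%R) -> (edge_density S T <= c * mu S)%R.
Proof.
move=> H; rewrite edge_densityE muE -integralZ; apply: integral_le => x.
by case: ifP => [/H|_] /=; lra.
Qed.

Lemma edge_densityC n (S T : {set cube n}) : edge_density S T = edge_density T S.
Proof. by rewrite /edge_density edge_bdC. Qed.

Lemma edge_densityUr n (S T U : {set cube n}) :
  (edge_density S (T :|: U) <= edge_density S T + edge_density S U)%R.
Proof.
rewrite !edge_densityE -integralD; apply: integral_le => x; case: ifP => _; last lra.
by rewrite -INR_addn; apply: INR_leq; exact: degU.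
Qed.

Lemma edge_densitySr n (S T U : {set cube n}) : T \subset U ->
  (edge_density S T <= edge_density S U)%R.
Proof.
move=> TU; rewrite !edge_densityE; apply: integral_le => x; case: ifP => _; last lra.
by apply: INR_leq; exact: degS.
Qed.

Lemma edge_densitySl n (S T U : {set cube n}) : T \subset U ->
  (edge_density T S <= edge_density U S)%R.
Proof. by move=> TU; rewrite ![edge_density _ S]edge_densityC; exact: edge_densitySr. Qed.

(* The edges leaving [C] account for [k 2^-k] up to lower order; the parts of [A] outside [C] and of [B] inside [C]
   are small sets, hence send more than [k] new [A]-[B] edges per vertex. *)
Lemma subcube_bootstrap k f g : admissible k f g -> exists d K e1,
  [/\ (0 < d)%R, (0 < K)%R, (0 < e1)%R &
  forall n eps (A B W : {set cube n}) (I : {set 'I_n}) (z : cube n), (0 < eps <= e1)%R ->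
    near_optimal k f eps A B W -> #|I| = k ->
    (mu (symdiff (std_subcube I z) A) <= d)%R ->
  (mu (symdiff (std_subcube I z) A) <= K * eps)%R /\
  forall i, i \in I -> ((1 - K * eps) / 2 ^ k <= INR (dir_bd A i) / 2 ^ n)%R].
Proof.
move=> adm; have [c1 [c10 boundW]] := near_optimal_W adm.
have k0 : 0 < k by case: adm => -[].
have kR : (1 <= INR k)%R by apply: (INR_leq k0).
have K0 := pow2_gt0 k; have [Ki0 Ki1] := Rinv_pow2 k.
have K1 : (1 <= 2 ^ k)%R by apply: pow_R1_Rle; lra.
(* For [X], 1 is lost to edges into [C], 1 in [out], and [k] because [mu Z] is [mu A - mu X]; for
   [Y], [k] is lost to edges leaving [C]. With [k + 3] both keep a coefficient of at least 1. *)
have [eta [eta0 expand]] := @small_set_expansion (INR k + 3)%R ltac:(lra).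
pose b := (2 * INR k + 4 * c1)%R.
have b0 : (0 < b)%R by rewrite /b; lra.
(* The second constant comes from [mu Z - mu X = mu A - 2 * mu X], written as a multiple of
   [2^-k]. *)
exists (eta / 2)%R, (1 + 2 * 2 ^ k * b)%R, (eta / 2 / c1)%R; split.
- lra.
- have : (0 < 2 * 2 ^ k * b)%R by apply: Rmult_lt_0_compat; lra.
  lra.
- by apply: Rdiv_lt_0_compat; lra.
move=> n eps A B W I z [ep0 epe] near cI muCA; set C := std_subcube I z in muCA *.
have [_ _ Wc sW] := boundW n eps A B W ep0 near.
have [[n0 dAB dAW dBW ABW] [[muA1 muA2] _ edge]] := near.
have W0 := mu_ge0 W.
have subC : subcube k C by exists I, z.
have ce : (c1 * eps <= eta / 2)%R.
  have -> : (eta / 2 = c1 * (eta / 2 / c1))%R by field; lra.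
  by apply: Rmult_le_compat_l; lra.
have part x : [|| x \in A, x \in B | x \in W].
  by have := in_setT x; rewrite -ABW !in_setU orbA.
pose X := A :\: C; pose Y := B :&: C; pose Z := A :&: C.
have muX : (mu X <= eta / 2)%R by apply: Rle_trans muCA; apply: mu_le; exact: subsetUr.
have muY : (mu Y <= eta / 2)%R.
  apply: Rle_trans muCA; apply: mu_le; apply/subsetP => x; rewrite in_setI in_setU !in_setD => /andP [xB ->].
  by rewrite (disjointFl dAB xB).
have muA : mu A = (mu Z + mu X)%R.
  rewrite -mu_disjointU; first by rewrite /Z /X setID.
  by apply: disjoint_setIP => x; rewrite in_setI in_setD => /andP [_ ->].
have symd : (mu (symdiff C A) <= mu X + mu Y + mu W)%R.
  apply: Rle_trans (_ : mu (X :|: Y :|: W) <= _)%R.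
    apply: mu_le; apply/subsetP => x; rewrite !in_setU !in_setD in_setI.
    by have := part x; case: (x \in A); case: (x \in B); case: (x \in C).
  apply: Rle_trans (mu_setU _ _) _; apply: Rplus_le_compat_r; exact: mu_setU.
have X0 := mu_ge0 X; have Y0 := mu_ge0 Y.
have degC x : x \notin C -> (INR (deg C x) <= 1)%R.
  by move=> xC; apply: (INR_leq (n := 1)); exact: deg_std_subcube.
have expX : ((INR k + 3) * mu X <= edge_density X B + mu X + c1 * eps)%R.
  have dXW : [disjoint X & W] by apply: disjointWl dAW; exact: subsetDl.
  have small : (mu (X :|: W) <= eta)%R by apply: Rle_trans (mu_setU _ _) _; lra.
  have E := expand n X W dXW small.
  have XXW : (mu X <= mu (X :|: W))%R by apply: mu_le; exact: subsetUl.
  have : (edge_density X (~: (X :|: W)) <= edge_density X B + 1 * mu X)%R.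
    apply: Rle_trans (_ : edge_density X (B :|: C) <= _)%R.
      apply: edge_densitySr; apply/subsetP => x; rewrite in_setC !in_setU in_setD.
      by have := part x; case: (x \in A); case: (x \in B); case: (x \in C); case: (x \in W).
    apply: Rle_trans (edge_densityUr _ _ _) _; apply: Rplus_le_compat_l.
    by apply: edge_density_le => x; rewrite in_setD => /andP [/degC].
  nra.
have expY : ((INR k + 3) * mu Y <= edge_density Z Y + INR k * mu Y + c1 * eps)%R.
  have dYW : [disjoint Y & W] by apply: disjointWl dBW; exact: subsetIl.
  have small : (mu (Y :|: W) <= eta)%R by apply: Rle_trans (mu_setU _ _) _; lra.
  have E := expand n Y W dYW small.
  have YYW : (mu Y <= mu (Y :|: W))%R by apply: mu_le; exact: subsetUl.
  have : (edge_density Y (~: (Y :|: W)) <= edge_density Z Y + INR k * mu Y)%R.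
    apply: Rle_trans (_ : edge_density Y (Z :|: ~: C) <= _)%R.
      apply: edge_densitySr; apply/subsetP => x; rewrite !(in_setC, in_setU) !in_setI.
      by have := part x; case: (x \in A); case: (x \in B); case: (x \in C); case: (x \in W).
    apply: Rle_trans (edge_densityUr _ _ _) _; rewrite (edge_densityC Z); apply: Rplus_le_compat_l.
    apply: edge_density_le => x; rewrite in_setI => /andP [_ xC].
    by rewrite (subcube_deg subC xC); exact: Rle_refl.
  nra.
(* Each point of [Z] sends [k] edges out of [C]; those ending in [X] or [W] are few, as a point
   outside [C] has at most one neighbour in [C]. *)
have out : (INR k * mu Z <= edge_density Z (B :\: C) + mu X + mu W)%R.
  have eX : (edge_density C X <= 1 * mu X)%R.
    rewrite edge_densityC; apply: edge_density_le => x; rewrite in_setD => /andP [/degC].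
    by [].
  have eW : (edge_density C (W :\: C) <= 1 * mu W)%R.
    rewrite edge_densityC; apply: Rle_trans (_ : 1 * mu (W :\: C) <= _)%R.
      by apply: edge_density_le => x; rewrite in_setD => /andP [/degC].
    by rewrite !Rmult_1_l; apply: mu_le; exact: subsetDl.
  have ZC : Z \subset C by exact: subsetIr.
  have eX' := edge_densitySl X ZC; have eW' := edge_densitySl (W :\: C) ZC.
  suff : (INR k * mu Z <= edge_density Z (B :\: C) + (edge_density Z X + edge_density Z (W :\: C)))%R by lra.
  have -> : (INR k * mu Z = edge_density Z (~: C))%R.
    rewrite edge_densityE muE -integralZ; apply: eq_integral => x.
    case: ifP => xZ /=; last by ring.
    by rewrite (subcube_deg subC) ?Rmult_1_r //; exact: (subsetP ZC).
  apply: Rle_trans (_ : edge_density Z ((B :\: C) :|: (X :|: (W :\: C))) <= _)%R.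
    apply: edge_densitySr; apply/subsetP => x; rewrite !in_setU !in_setD in_setC.
    by have := part x; case: (x \in A); case: (x \in B); case: (x \in C); case: (x \in W).
  apply: Rle_trans (edge_densityUr _ _ _) _; apply: Rplus_le_compat_l; exact: edge_densityUr.
have total : (edge_density X B + edge_density Z Y + edge_density Z (B :\: C) <= edge_density A B)%R.
  rewrite !edge_densityE -!integralD; apply: integral_le => x.
  rewrite /X /Z in_setD !in_setI; case: (x \in A); last by rewrite andbF /=; lra.
  case: (x \in C) => /=; last lra.
  rewrite Rplus_0_l -INR_addn; apply: INR_leq.
  rewrite !degE -big_split /=; apply: leq_sum => i _; rewrite /Y in_setI in_setD.
  by case: (flip x i \in B); case: (flip x i \in C).
rewrite /Rdiv in muA1 edge.
set q := (/ 2 ^ k)%R in Ki0 Ki1 muA1 muA2 edge.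
have kq : (INR k * ((1 - eps) * q) <= INR k * mu A)%R by apply: Rmult_le_compat_l; lra.
have kq1 : (0 <= eps * INR k * (1 - q))%R by repeat apply: Rmult_le_pos; lra.
have XY : (mu X + mu Y + mu W <= b * eps)%R.
  rewrite muA in kq; rewrite /b; nra.
have bK : (b * eps <= 2 * 2 ^ k * b * eps)%R.
  have : (0 <= b * eps * (2 * 2 ^ k - 1))%R by repeat apply: Rmult_le_pos; lra.
  lra.
split; first lra.
move=> i iI.
(* Flipping [i] takes every point of [Z] out of [C], and the image stays in [A] only if it falls in
   [X]. *)
have ZX : (mu Z - mu X <= INR (dir_bd A i) / 2 ^ n)%R.
  rewrite dir_bdE -[(_ / _)%R]/(mu _) -(mu_preim_shift [set i] X).
  apply: Rle_trans (mu_setD _ _) _; apply: mu_le; apply/subsetP => x.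
  rewrite in_setD inE shift_set1 in_setI in_setD negb_and negbK => /andP [H /andP [xA xC]].
  rewrite inE xA /=; case/orP: H => // fC; exfalso.
  move: xC fC; rewrite !inE => /forall_inP/(_ i iI)/eqP xi /forall_inP/(_ i iI).
  by rewrite flipE eqxx xi; case: (z i).
apply: Rle_trans ZX; rewrite /Rdiv -/q.
have -> : ((1 - (1 + 2 * 2 ^ k * b) * eps) * q = (1 - eps) * q - 2 * b * eps * (2 ^ k * q))%R by ring.
rewrite Rinv_r; lra.
Qed.

(** * Conclusion: small [eps] by approximation and bootstrap, large [eps] trivially *)

Theorem theorem1p11 (k : nat) (f g : R -> R) :
  (0 < k)%N ->
  (* g : [0,1] -> [0,oo) continuous *)
  (forall x, (0 <= x <= 1)%R -> (0 <= g x)%R) ->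
  (forall x, (0 <= x <= 1)%R -> forall eps, (0 < eps)%R ->
     exists delta, (0 < delta)%R /\
       forall y, (0 <= y <= 1)%R -> (Rabs (y - x) < delta)%R ->
         (Rabs (g y - g x) < eps)%R) ->
  g (/ 2 ^ k)%R = (INR k / 2 ^ k)%R ->
  (* f : [0,oo) -> [0,oo) increasing, strictly concave, f 0 = 0, f k = k *)
  (forall x, (0 <= x)%R -> (0 <= f x)%R) ->
  (forall x y, (0 <= x)%R -> (x < y)%R -> (f x < f y)%R) ->
  (forall x y t, (0 <= x)%R -> (0 <= y)%R -> x <> y -> (0 < t < 1)%R ->
     (t * f x + (1 - t) * f y < f (t * x + (1 - t) * y))%R) ->
  f 0%R = 0%R ->
  f (INR k) = INR k ->
  (* edge-isoperimetric hypothesis *)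
  (forall (n : nat) (A : {set cube n}), (1 <= n)%N ->
     (g (mu A) <= integral (fun x => f (INR (hS A x))))%R) ->
  exists K : R, (0 < K)%R /\
    forall (n : nat) (eps : R) (A B W : {set cube n}),
      (k <= n)%N ->
      (0 < eps)%R ->
      [disjoint A & B] -> [disjoint A & W] -> [disjoint B & W] ->
      A :|: B :|: W = [set: cube n] ->
      ((1 - eps) / 2 ^ k <= mu A <= (1 + eps) / 2 ^ k)%R ->
      (mu W <= eps / f (INR n))%R ->
      (INR (edge_bd A B) < (1 + eps) * INR k * 2 ^ n / 2 ^ k)%R ->
      (exists I : {set 'I_n}, #|I| = k /\
         forall i, i \in I -> ((1 - K * eps) * 2 ^ n / 2 ^ k <= INR (dir_bd A i))%R) /\
      (exists C : {set cube n}, subcube k C /\ (mu (symdiff C A) <= K * eps)%R).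
Proof.
move=> k0 _ gC gk f_ge0 f_inc fC f0 fk iso.
have adm : admissible k f g by [].
have [d [K [e1 [d0 K0 e10 boot]]]] := subcube_bootstrap adm.
have [e2 [e20 approx]] := near_subcube adm d0.
pose e0 := Rmin e1 e2.
have e00 : (0 < e0)%R by apply: Rmin_pos.
have e0V := Rinv_0_lt_compat _ e00.
(* The summand [/ e0] makes the constant times [eps] at least 1 once [eps] exceeds [e0]; any [k]
   coordinates and any subcube fixing them then work. *)
exists (K + / e0)%R; split; first lra.
move=> n eps A B W kn ep0 dAB dAW dBW ABW muA muW edge.
have N := pow2_gt0 n; have [q0 q1] := Rinv_pow2 k.
case: (Rle_lt_dec eps e0) => [ep|ep].
  have near : near_optimal k f eps A B W.
    split; split=> //; first exact: leq_trans k0 kn.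
    rewrite /edge_density; apply: (Rmult_le_reg_r (2 ^ n)) => //.
    have -> : (INR (edge_bd A B) / 2 ^ n * 2 ^ n = INR (edge_bd A B))%R by field; lra.
    by rewrite /Rdiv in edge *; lra.
  have h1 := Rmin_l e1 e2; have h2 := Rmin_r e1 e2; rewrite -/e0 in h1 h2.
  have [C [[I [z [cI CE]]] muC]] := approx n eps A B W kn ltac:(lra) near.
  rewrite CE in muC.
  have [muK dirK] := boot n eps A B W I z ltac:(lra) near cI muC.
  have KK : (K * eps <= (K + / e0) * eps)%R by apply: Rmult_le_compat_r; lra.
  split; last first.
    exists (std_subcube I z); split; first by exists I, z.
    exact: Rle_trans muK KK.
  exists I; split=> // i iI; have := dirK i iI.
  move/(Rmult_le_compat_r (2 ^ n) _ _ (Rlt_le _ _ N)).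
  have -> : (INR (dir_bd A i) / 2 ^ n * 2 ^ n = INR (dir_bd A i))%R by field; lra.
  apply: Rle_trans; rewrite /Rdiv.
  have : (0 <= ((K + / e0) * eps - K * eps) * / 2 ^ k * 2 ^ n)%R by repeat apply: Rmult_le_pos; lra.
  lra.
have big : (1 <= (K + / e0) * eps)%R.
  have : (/ e0 * e0 <= / e0 * eps)%R by apply: Rmult_le_compat_l; lra.
  rewrite Rinv_l; last lra.
  have : (0 <= K * eps)%R by apply: Rmult_le_pos; lra.
  lra.
have [I cI] := exists_set_card kn.
split; last first.
  exists (std_subcube I [ffun=> false]); split; first by exists I, [ffun=> false].
  exact: Rle_trans (mu_le1 _) big.
exists I; split=> // i _; apply: Rle_trans (pos_INR _); rewrite /Rdiv.
have : (0 <= ((K + / e0) * eps - 1) * 2 ^ n * / 2 ^ k)%R by repeat apply: Rmult_le_pos; lra.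
lra.
Qed.
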